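(* Consider the general stochastic block model with $r\ge1$ clusters of sizes $K_k=\rho_k n$ ($k\in[r]$) and $n-\sum_kK_k$ outlier vertices, with $a>b>0$ and $\rho_1\ge\dots\ge\rho_r>0$ fixed. Suppose there exist $\psi_1>0,\psi_2>0$ with $b+\psi_1+\psi_2<a$ such that $$I(a,b+\psi_1+\psi_2)>1/\rho_r,\quad I(b,b+\psi_1)>1/\rho_r,\quad I(b,b+\psi_2)>1/\rho_{r-1},\quad I(b,b+\psi_1+\psi_2)>1/\rho_r,$$ where the second and third conditions are dropped if $r=1$, and the fourth condition is dropped unless $r=1$ and there are outlier vertices. Let $\eta^*=C\sqrt{\log n}$ for a sufficiently large constant $C$ and $\lambda^*=(b+\psi_1+\psi_2)\frac{\log n}{n}$. Let $\widehat Z_{\mathrm{SDP}}$ be produced by either (i) $\max_Z\langle A,Z\rangle$ s.t. $Z\succeq0$, $Z_{ii}\le1$, $Z_{ij}\ge0$, $\langle\mathbf I,Z\rangle=K_1+\dots+K_r$, $\langle\mathbf J,Z\rangle=K_1^2+\dots+K_r^2$; or (ii) $\max_Z\langle A,Z\rangle-\eta^*\langle\mathbf I,Z\rangle-\lambda^*\langle\mathbf J,Z\rangle$ s.t. $Z\succeq0$, $Z_{ii}\le1$, $Z_{ij}\ge0$. Then $\min_{Z^*\in\mathcal Z_n}\mathbb P\{\widehat Z_{\mathrm{SDP}}=Z^*\}\ge1-n^{-\Omega(1)}$ (where $\widehat Z_{\mathrm{SDP}}=Z^*$ means $Z^*$ is the unique optimal solution).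
   Context: General SBM: out of $n$ vertices, disjoint clusters $C_1,\dots,C_r$ of sizes $K_1,\dots,K_r$ are planted and the remaining vertices are outliers (belonging to no cluster). Two vertices in the same cluster are connected with probability $p=a\log n/n$; every other pair is connected with probability $q=b\log n/n$, all independently. $A$ is the adjacency matrix. $\xi^*_k$ is the indicator vector of $C_k$, $Z^*=\sum_{k=1}^r\xi^*_k(\xi^*_k)^\top$, and $\mathcal Z_n$ is the set of all such cluster matrices (for the given sizes). $\mathbf I$ is the identity and $\mathbf J$ the all-ones matrix. For $\mu,d>0$, $I(\mu,d)=\mu-d\log\frac{e\mu}{d}$. *)

(* Defs.v *)
From Stdlib Require Import Reals Lra Lia List Classical ClassicalEpsilon.
Import ListNotations.
Open Scope R_scope.

(** Vertices are 0..n-1; matrices are functions nat -> nat -> R, only the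
    entries with indices < n are meaningful. *)

Fixpoint rsum (n : nat) (f : nat -> R) : R :=
  match n with
  | O => 0
  | S m => rsum m f + f m
  end.

Definition inner (n : nat) (X Y : nat -> nat -> R) : R :=
  rsum n (fun i => rsum n (fun j => X i j * Y i j)).

Definition Imat : nat -> nat -> R := fun i j => if Nat.eqb i j then 1 else 0.
Definition Jmat : nat -> nat -> R := fun _ _ => 1.

Definition psd (n : nat) (Z : nat -> nat -> R) : Prop :=
  (forall i j, (i < n)%nat -> (j < n)%nat -> Z i j = Z j i) /\
  forall x : nat -> R,
    0 <= rsum n (fun i => rsum n (fun j => x i * Z i j * x j)).

Definition mat_eq (n : nat) (X Y : nat -> nat -> R) : Prop :=
  forall i j, (i < n)%nat -> (j < n)%nat -> X i j = Y i j.

Definition unique_opt (n : nat) (feas : (nat -> nat -> R) -> Prop)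
  (obj : (nat -> nat -> R) -> R) (Zs : nat -> nat -> R) : Prop :=
  feas Zs /\ forall Z, feas Z -> obj Zs <= obj Z -> mat_eq n Z Zs.

Definition sdp_box (n : nat) (Z : nat -> nat -> R) : Prop :=
  psd n Z /\
  (forall i, (i < n)%nat -> Z i i <= 1) /\
  (forall i j, (i < n)%nat -> (j < n)%nat -> 0 <= Z i j).

Definition Ifun (mu d : R) : R := mu - d * ln (exp 1 * mu / d).

(** Cluster sizes K_k = floor(rho_k n), k = 0..r-1 (paper's k = 1..r). *)
Definition Ksize (rho : nat -> R) (k n : nat) : nat :=
  Z.to_nat (Int_part (rho k * INR n)).

(** A cluster assignment: sigma i = Some k means vertex i is in cluster k,
    None means i is an outlier. *)
Definition in_cluster (sigma : nat -> option nat) (k i : nat) : bool :=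
  match sigma i with Some k' => Nat.eqb k' k | None => false end.

Definition valid_assignment (n r : nat) (rho : nat -> R)
  (sigma : nat -> option nat) : Prop :=
  (forall i, (i < n)%nat ->
     match sigma i with Some k => (k < r)%nat | None => True end) /\
  (forall k, (k < r)%nat ->
     length (filter (in_cluster sigma k) (seq 0 n)) = Ksize rho k n).

(** Cluster matrix Z* = sum_k xi_k xi_k^T. *)
Definition cluster_matrix (sigma : nat -> option nat) : nat -> nat -> R :=
  fun i j => match sigma i, sigma j with
             | Some k, Some l => if Nat.eqb k l then 1 else 0
             | _, _ => 0
             end.

Definition same_cluster (sigma : nat -> option nat) (i j : nat) : bool :=
  match sigma i, sigma j with
  | Some k, Some l => Nat.eqb k l
  | _, _ => false
  end.

Definition ind (P : Prop) : R :=
  if excluded_middle_informative P then 1 else 0.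

(** Edge configurations: g i j for i < j. *)
Definition upd (g : nat -> nat -> bool) (i j : nat) (b : bool) :
  nat -> nat -> bool :=
  fun x y => if andb (Nat.eqb x i) (Nat.eqb y j) then b else g x y.

Definition adj (g : nat -> nat -> bool) : nat -> nat -> R :=
  fun i j =>
    if Nat.ltb i j then (if g i j then 1 else 0)
    else if Nat.ltb j i then (if g j i then 1 else 0) else 0.

Definition pairs (n : nat) : list (nat * nat) :=
  flat_map (fun j => map (fun i => (i, j)) (seq 0 j)) (seq 0 n).

(** Probability, under independent edges with probabilities w (i, j),
    that the adjacency matrix satisfies E (exact finite sum over all
    edge configurations). *)
Fixpoint prob_rec (l : list (nat * nat)) (w : nat -> nat -> R)
  (g : nat -> nat -> bool) (E : (nat -> nat -> R) -> Prop) : R :=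
  match l with
  | [] => ind (E (adj g))
  | (i, j) :: l' =>
      w i j * prob_rec l' w (upd g i j true) E
      + (1 - w i j) * prob_rec l' w (upd g i j false) E
  end.

Definition prob (n : nat) (w : nat -> nat -> R)
  (E : (nat -> nat -> R) -> Prop) : R :=
  prob_rec (pairs n) w (fun _ _ => false) E.

Definition sbm_w (n : nat) (a b : R) (sigma : nat -> option nat) :
  nat -> nat -> R :=
  fun i j => if same_cluster sigma i j then a * ln (INR n) / INR n
             else b * ln (INR n) / INR n.

Definition sumK (r : nat) (rho : nat -> R) (n : nat) : R :=
  rsum r (fun k => INR (Ksize rho k n)).
Definition sumK2 (r : nat) (rho : nat -> R) (n : nat) : R :=
  rsum r (fun k => INR (Ksize rho k n) ^ 2).

Definition feas1 (n r : nat) (rho : nat -> R) (Z : nat -> nat -> R) : Prop :=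
  sdp_box n Z /\ inner n Imat Z = sumK r rho n /\ inner n Jmat Z = sumK2 r rho n.

Definition obj2 (n : nat) (eta lam : R) (A Z : nat -> nat -> R) : R :=
  inner n A Z - eta * inner n Imat Z - lam * inner n Jmat Z.

(* Main.v *)
Require Import Defs.
From Stdlib Require Import Reals List.
From Stdlib Require FunctionalExtensionality Classical Lra.
From mathcomp Require all_boot all_order all_algebra.
From mathcomp Require reals Rstruct zify ring lra.
Open Scope R_scope.

(** Optimality of the cluster matrix is certified by
    [S = D - B - A + eta I + lam J], where [S] kills the cluster indicators.
    On vectors [y] summing to zero on each cluster, [B] contributes nothing and
    [y^T S y >= (eta - ||A - E A||) |y|^2], so the certificate works as soon as
    [||A - E A|| <= C1 sqrt (log n)], the diagonal entries [D_i] of clustered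
    vertices are positive and [B] is positive between clusters.  The last two
    are degree conditions, obtained from Chernoff bounds whose exponents are
    the functions [I(mu, d)] of the hypotheses.

    The spectral bound is proved by the moment method.  In
    [E tr (A - E A)^(2k)], with [k] of order [log n], only closed walks using
    every edge at least twice survive, and a walk through [v] distinct vertices
    weighs at most [p^(v-1)].  Whether a walk survives depends only on its
    kernel (the pairs of times at which it visits the same vertex), so
    comparing, kernel by kernel, the number of walks in [n] and in [r] vertices
    gives [p E tr (A - E A)^(2k) <= E tr Y^(2k)] for a dense [r]-dimensional
    symmetric matrix [Y] with independent entries in [{2, -1}], where [r] is
    only of order [log n].  The norm of [Y] is bounded by subgaussian moments
    and a union bound over lattice points of a ball of radius [2 sqrt r]. *)

(* The module confines the notations of the library, which redefine [<=] on [nat]. *)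
Module Recovery.
Import FunctionalExtensionality Classical.
Import all_boot all_order all_algebra reals Rstruct zify ring lra.
Import Order.TTheory GRing.Theory Num.Theory.
Set Implicit Arguments.
Unset Strict Implicit.
Unset Printing Implicit Defensive.
Local Open Scope ring_scope.
Bind Scope ring_scope with R.
Local Arguments exp x%_ring_scope.

(** * Product measures on edge configurations *)

(** The degrees behind the certificate are of order [log n], and [eta] shifts their thresholds. So
    [eta] must be [o(log n)], and a norm bound of order [log n], as generic matrix concentration
    gives at this sparsity, would be useless. The order [sqrt (log n)] is what the comparison with a
    dense matrix provides. The pair [psi1], [psi2] comes from the positivity of [B] between two
    clusters: two degree densities must sum to less than [b + d] with [d = b + psi1 + psi2], and
    this budget is split as [(b + psi1) + (b + psi2)]. In every pair some cluster is not the last,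
    and it takes the share [b + psi2]; hence that condition involves the last size but one. With a
    single cluster only outliers are concerned, and they may use all of [d]. One certificate serves
    both programs, since (i) fixes [<I, Z>] and [<J, Z>], so that the penalties are constant there.
    The strictness of the hypotheses leaves room for a small [e] that absorbs [eta], the rounding of
    the cluster sizes and the spectral error, and yields the exponent of the failure probability. *)

Lemma eqbE (x y : nat) : Nat.eqb x y = (x == y).
Proof. by apply/idP/eqP => [/PeanoNat.Nat.eqb_eq|->]; rewrite ?PeanoNat.Nat.eqb_refl. Qed.

Lemma pairsE n : pairs n = [seq (i, j) | j <- iota 0 n, i <- iota 0 j].
Proof.
rewrite /pairs.
have seqE k l : List.seq k l = iota k l by elim: l k => //= l IH k; rewrite IH.
rewrite seqE /allpairs_dep; elim: (iota 0 n) => //= x s ->.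
rewrite seqE; done.
Qed.

Lemma mem_pairs n i j : ((i, j) \in pairs n) = (i < j < n)%N.
Proof.
rewrite pairsE; apply/allpairsPdep/idP => [[y [x [Hy Hx [-> ->]]]]|/andP[ij jn]].
  by move: Hy Hx; rewrite !mem_iota !add0n /= => -> ->.
by exists j, i; rewrite !mem_iota !add0n.
Qed.

Lemma uniq_pairs n : uniq (pairs n).
Proof.
rewrite pairsE; apply: allpairs_uniq_dep; first exact: iota_uniq.
- by move=> x _; exact: iota_uniq.
- by move=> [x1 y1] [x2 y2] _ _ [-> ->].
Qed.

(** The recursion of [prob_rec] with an arbitrary integrand in place of an indicator, so that
    expectations remain exact finite sums. *)
Fixpoint Ex (F : realFieldType) (l : seq (nat * nat)) (w : nat -> nat -> F)
  (g : nat -> nat -> bool) (f : (nat -> nat -> bool) -> F) : F :=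
  if l is (i, j) :: l' then
    w i j * Ex l' w (upd g i j true) f + (1 - w i j) * Ex l' w (upd g i j false) f
  else f g.

Definition is_prob (F : realFieldType) (l : seq (nat * nat)) (w : nat -> nat -> F) :=
  forall e, e \in l -> 0 <= w e.1 e.2 <= 1.

Lemma is_prob_cons (F : realFieldType) e l (w : nat -> nat -> F) :
  is_prob (e :: l) w -> 0 <= w e.1 e.2 <= 1 /\ is_prob l w.
Proof.
move=> H; split; first by apply: H; rewrite inE eqxx.
by move=> e' He'; apply: H; rewrite inE He' orbT.
Qed.

Lemma Ex_le (F : realFieldType) l (w : nat -> nat -> F) g f1 f2 :
  is_prob l w -> (forall g, f1 g <= f2 g) -> Ex l w g f1 <= Ex l w g f2.
Proof.
move=> Hw Hf; elim: l g Hw => [|[i j] l IH] g Hw //=.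
have [/= /andP[w0 w1] Hl] := is_prob_cons Hw.
by rewrite lerD // ler_wpM2l ?IH // subr_ge0.
Qed.

Lemma Ex_cst (F : realFieldType) l (w : nat -> nat -> F) g c : Ex l w g (fun=> c) = c.
Proof. by elim: l g => [|[i j] l IH] g //=; rewrite !IH; ring. Qed.

Lemma ExD (F : realFieldType) l (w : nat -> nat -> F) g f1 f2 :
  Ex l w g (fun g => f1 g + f2 g) = Ex l w g f1 + Ex l w g f2.
Proof. by elim: l g => [|[i j] l IH] g //=; rewrite !IH; ring. Qed.

Lemma ExZ (F : realFieldType) l (w : nat -> nat -> F) g c f :
  Ex l w g (fun g => c * f g) = c * Ex l w g f.
Proof. by elim: l g => [|[i j] l IH] g //=; rewrite !IH; ring. Qed.

(** The recursion rewrites only the entries listed in [l], so every configuration it reaches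
    coincides with [g] elsewhere. *)
Lemma Ex_off (F : realFieldType) l (w : nat -> nat -> F) g f1 f2 :
  (forall g', (forall i j, (i, j) \notin l -> g' i j = g i j) -> f1 g' = f2 g') ->
  Ex l w g f1 = Ex l w g f2.
Proof.
elim: l g => [|[i j] l IH] g H /=; first by apply: H.
congr (_ * _ + _ * _); apply: IH => g' Hg'; apply: H => x y;
  rewrite inE negb_or xpair_eqE => /andP[/negbTE xy /Hg' ->];
  by rewrite /upd !eqbE xy.
Qed.

Lemma Ex_ext (F : realFieldType) l (w : nat -> nat -> F) g f1 f2 :
  (forall g', f1 g' = f2 g') -> Ex l w g f1 = Ex l w g f2.
Proof. by move=> H; apply: Ex_off => g' _. Qed.

Lemma Ex_sum (F : realFieldType) l (w : nat -> nat -> F) g (I : Type) (r : seq I)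
  (P : pred I) (f : I -> _ -> F) :
  Ex l w g (fun g => \sum_(i <- r | P i) f i g) = \sum_(i <- r | P i) Ex l w g (f i).
Proof.
elim: r => [|x r IH].
  rewrite big_nil -[RHS](Ex_cst l w g); apply: Ex_ext => g'; exact: big_nil.
rewrite big_cons; case: ifP => Px; last first.
  by rewrite -IH; apply: Ex_ext => g'; rewrite big_cons Px.
by rewrite -IH -ExD; apply: Ex_ext => g'; rewrite big_cons Px.
Qed.

(** Independence of distinct edges; every exact computation of an expectation below goes through
    this product formula. *)
Lemma Ex_prod (F : realFieldType) l (w : nat -> nat -> F) g (h : nat * nat -> bool -> F) :
  uniq l ->
  Ex l w g (fun g => \prod_(e <- l) h e (g e.1 e.2)) =
  \prod_(e <- l) (w e.1 e.2 * h e true + (1 - w e.1 e.2) * h e false).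
Proof.
elim: l g => [|[i j] l IH] g /=; first by rewrite !big_nil.
case/andP=> Hij Hl; rewrite [RHS]big_cons -(IH g Hl).
have step b : Ex l w (upd g i j b)
    (fun g => \prod_(e <- (i, j) :: l) h e (g e.1 e.2)) =
    h (i, j) b * Ex l w g (fun g => \prod_(e <- l) h e (g e.1 e.2)).
  (* By the induction hypothesis the expectation over [l] does not depend on the initial
     configuration, so [g] may be traded for [upd g i j b]. *)
  rewrite IH // -(IH (upd g i j b) Hl) -ExZ; apply: Ex_off => g' Hg'.
  rewrite big_cons /=; congr (h _ _ * _).
  by rewrite Hg' // /upd !PeanoNat.Nat.eqb_refl.
by rewrite !step /=; ring.
Qed.

Definition edge (i j : nat) : nat * nat := (minn i j, maxn i j).

Lemma edgeC i j : edge i j = edge j i.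
Proof. by rewrite /edge minnC maxnC. Qed.

Lemma edge_pairs n (i j : 'I_n) : (edge i j \in pairs n) = (i != j).
Proof.
by rewrite mem_pairs -(inj_eq val_inj) /=; have := ltn_ord i; have := ltn_ord j; lia.
Qed.

Lemma edge_eq i j k l :
  (edge i j == edge k l) = ((i == k) && (j == l)) || ((i == l) && (j == k)).
Proof.
by rewrite /edge xpair_eqE; apply/idP/idP; lia.
Qed.

(** * Walks with a common kernel *)

(** There is one first visit per visited vertex, so [#|firsts w|] counts distinct vertices. Unlike
    the image of [w], this set of times is determined by the kernel. *)
Definition firsts m (T : eqType) (w : {ffun 'I_m -> T}) : {set 'I_m} :=
  [set t : 'I_m | [forall s : 'I_m, (s < t)%N ==> (w s != w t)]].

Definition same_kernel m (T U : eqType) (w : {ffun 'I_m -> T}) (u : {ffun 'I_m -> U}) :=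
  [forall s, forall t, (w s == w t) == (u s == u t)].

Lemma same_kernelP m (T U : eqType) (w : {ffun 'I_m -> T}) (u : {ffun 'I_m -> U}) :
  reflect (forall s t, (w s == w t) = (u s == u t)) (same_kernel w u).
Proof.
apply: (iffP forallP) => [H s t|H s]; first by have /forallP/(_ t)/eqP := H s.
by apply/forallP => t; rewrite H.
Qed.

Lemma same_kernel_sym m (T U : eqType) (w : {ffun 'I_m -> T}) (u : {ffun 'I_m -> U}) :
  same_kernel w u = same_kernel u w.
Proof. by apply/same_kernelP/same_kernelP => H s t; rewrite H. Qed.

Lemma firsts_kernel m (T U : eqType) (w : {ffun 'I_m -> T}) (u : {ffun 'I_m -> U}) :
  same_kernel w u -> firsts w = firsts u.
Proof.
move=> /same_kernelP H; apply/setP => t; rewrite !inE.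
by apply: eq_forallb => s; rewrite H.
Qed.

Lemma first_occ m (T : eqType) (w : {ffun 'I_m -> T}) t :
  exists2 s, s \in firsts w & w s = w t.
Proof.
case: (@arg_minnP _ t (fun s : 'I_m => w s == w t) (fun s => val s) (eqxx (w t))) => /= s /eqP st smin.
exists s => //; rewrite inE; apply/forallP => s'; apply/implyP => lt.
by apply: contraL lt => /eqP e; rewrite -leqNgt; apply: smin; rewrite e st.
Qed.

Lemma firsts_inj m (T : eqType) (w : {ffun 'I_m -> T}) s t :
  s \in firsts w -> t \in firsts w -> w s = w t -> s = t.
Proof.
rewrite !inE => /forallP Hs /forallP Ht e; apply: val_inj; case: (ltngtP s t) => // lt.
  by have := Ht s; rewrite lt e eqxx.
by have := Hs t; rewrite lt e eqxx.
Qed.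

(** A function with the kernel of [w] is determined by its values at the first-visit times, which
    may be any distinct elements of [V]. *)
Lemma card_kernel m (T : eqType) (V : finType) (w : {ffun 'I_m -> T}) :
  #|[set u : {ffun 'I_m -> V} | same_kernel w u]| = (#|V| ^_ #|firsts w|)%N.
Proof.
pose S := {t | t \in firsts w}.
have exS t : exists s : S, w (val s) == w t.
  by have [s Hs e] := first_occ w t; exists (exist _ s Hs); rewrite /= e.
pose fst t : S := xchoose (exS t).
have fstP t : w (val (fst t)) = w t by apply/eqP; exact: (xchooseP (exS t)).
have fstK s : fst (val s) = s.
  by apply: val_inj; apply: (@firsts_inj _ _ w); rewrite ?fstP //; exact: valP.
have -> : [set u : {ffun 'I_m -> V} | same_kernel w u] =
    (fun f : {ffun S -> V} => [ffun t : 'I_m => f (fst t)]) @: [set f : {ffun S -> V} | injectiveb f].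
  apply/setP => u; rewrite inE; apply/same_kernelP/imsetP => [H|[f]].
    exists [ffun s : S => u (val s)].
      rewrite inE; apply/injectiveP => s1 s2; rewrite !ffunE => /eqP.
      rewrite -H => /eqP e; apply: val_inj; exact: firsts_inj (valP s1) (valP s2) e.
    by apply/ffunP => t; rewrite !ffunE; apply/eqP; rewrite -H fstP.
  rewrite inE => /injectiveP inj -> s t; rewrite !ffunE (inj_eq inj).
  apply/eqP/eqP => [e|e]; last by rewrite -(fstP s) -(fstP t) e.
  by apply: val_inj; apply: (@firsts_inj _ _ w); rewrite ?fstP //; exact: valP.
rewrite card_imset; last first.
  move=> f f' /ffunP e; apply/ffunP => s.
  by have := e (val s); rewrite !ffunE fstK.
by rewrite card_inj_ffuns card_sig.
Qed.

Lemma ffact_le_exp n v : (n ^_ v <= n ^ v)%N.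
Proof.
elim: v => // v IH; rewrite ffactnSr expnSr leq_mul //; exact: leq_subr.
Qed.

(** Each factor [r - i] with [i < N] is at least [r / 2]. *)
Lemma exp_le_ffact r v N : (v <= N -> 2 * N <= r -> r ^ v <= 2 ^ v * r ^_ v)%N.
Proof.
move=> vN Nr; elim: v vN => // v IH vN.
rewrite ffactnSr !expnSr.
have -> : (2 ^ v * 2 * (r ^_ v * (r - v)) = 2 ^ v * r ^_ v * (2 * (r - v)))%N by ring.
by apply: leq_mul; [apply: IH; lia|lia].
Qed.

(* Each class of walks with a common kernel has [r ^_ v] members in ['I_r], against at most
   [n ^ v] in ['I_n], where [v] is the number of distinct vertices. *)
Lemma kernel_comparison (F : realFieldType) m n r (p : F)
  (P : pred {ffun 'I_m -> 'I_n}) (Q : pred {ffun 'I_m -> 'I_r}) :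
  (forall w u, same_kernel w u -> P w = Q u) ->
  0 <= p -> (2 * m <= r)%N -> 2 * (n%:R * p) <= r%:R ->
  \sum_(w | P w) p ^+ #|firsts w| <= \sum_(u | Q u) 1.
Proof.
move=> PQ p0 mr npr.
have fm (T : eqType) (w : {ffun 'I_m -> T}) : (#|firsts w| <= m)%N.
  by rewrite -[X in (_ <= X)%N]card_ord max_card.
have ff0 (T : eqType) (w : {ffun 'I_m -> T}) : (0 < (r ^_ #|firsts w|))%N.
  by rewrite ffact_gt0; have := fm _ w; lia.
(* Double counting: each weight is spread evenly over the walks in ['I_r] with the same kernel.
   After the exchange of sums only the count for a single [u] remains. *)
have -> : \sum_(w | P w) p ^+ #|firsts w| =
  \sum_(w | P w) \sum_(u | Q u && same_kernel w u) p ^+ #|firsts u| / (r ^_ #|firsts u|)%:R.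
  apply: eq_bigr => w Pw.
  rewrite (eq_bigl (fun u => u \in [set u | same_kernel w u])); last first.
    by move=> u; rewrite inE; case K : (same_kernel w u); rewrite ?andbF ?andbF // -(PQ _ _ K) Pw.
  rewrite (eq_bigr (fun=> p ^+ #|firsts w| / (r ^_ #|firsts w|)%:R)); last first.
    by move=> u; rewrite inE => /firsts_kernel ->.
  rewrite sumr_const card_kernel card_ord -[RHS]mulr_natr mulfVK //.
  by rewrite pnatr_eq0 -lt0n.
rewrite (exchange_big_dep Q) /=; last by move=> w u _ /andP[].
apply: ler_sum => u Qu.
rewrite (eq_bigl (fun w => w \in [set w | same_kernel u w])); last first.
  move=> w; rewrite inE [RHS]same_kernel_sym.
  case K : (same_kernel w u); last by rewrite !andbF.
  by rewrite (PQ _ _ K) Qu.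
rewrite sumr_const card_kernel card_ord -[leLHS]mulr_natr mulrAC ler_pdivrMr; last first.
  by rewrite ltr0n.
rewrite mul1r; set v := #|firsts u|.
have H1 : (n ^_ v)%:R <= (n%:R : F) ^+ v by rewrite -natrX ler_nat ffact_le_exp.
have H2 : (r%:R : F) ^+ v <= 2 ^+ v * (r ^_ v)%:R.
  by rewrite -!natrX -natrM ler_nat (exp_le_ffact (N := m)) // fm.
have H3 : 2 ^+ v * (p ^+ v * (n ^_ v)%:R) <= 2 ^+ v * (r ^_ v)%:R.
  apply: le_trans H2; apply: (@le_trans _ _ (2 ^+ v * (p ^+ v * n%:R ^+ v))).
    by rewrite !ler_wpM2l // exprn_ge0.
  rewrite -!exprMn; apply: lerXn2r; rewrite ?nnegrE ?ler0n ?mulr_ge0 ?ler0n //.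
  by rewrite (mulrC p).
by rewrite -(ler_pM2l (x := 2 ^+ v)) // exprn_gt0.
Qed.

(** * Traces of powers of random symmetric matrices *)

Definition src m (t : 'I_m) : 'I_m.+1 := widen_ord (leqnSn m) t.
Definition tgt m (t : 'I_m) : 'I_m.+1 := lift ord0 t.

Lemma mxpow_walks (F : realFieldType) n m (A : 'M[F]_n) i j :
  (A ^+ m) i j = \sum_(w : {ffun 'I_m.+1 -> 'I_n} | (w ord0 == i) && (w ord_max == j))
    \prod_(t < m) A (w (src t)) (w (tgt t)).
Proof.
elim: m i => [|m IH] i.
  have Emax : (ord_max : 'I_1) = ord0 by apply: val_inj.
  rewrite expr0 mxE Emax; case: (eqVneq i j) => [<-|ij].
    rewrite (big_pred1 [ffun=> i]) ?big_ord0 // => w; rewrite andbb.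
    by apply/eqP/eqP => [e|->]; [apply/ffunP => t; rewrite ffunE (ord1 t)|rewrite ffunE].
  rewrite big1 // => w /andP[/eqP e /eqP e']; by rewrite -e -e' eqxx in ij.
rewrite exprS mxE.
transitivity (\sum_(w : {ffun 'I_m.+1 -> 'I_n} | w ord_max == j)
    A i (w ord0) * \prod_(t < m) A (w (src t)) (w (tgt t))).
  rewrite (eq_bigr (fun l => \sum_(w : {ffun 'I_m.+1 -> 'I_n} | (w ord0 == l) && (w ord_max == j))
     A i (w ord0) * \prod_(t < m) A (w (src t)) (w (tgt t)))); last first.
    by move=> l _; rewrite IH big_distrr; apply: eq_bigr => w /andP[/eqP -> _].
  rewrite (exchange_big_dep (fun w : {ffun 'I_m.+1 -> 'I_n} => w ord_max == j)) /=; last first.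
    by move=> l w _ /andP[].
  by apply: eq_bigr => w ->; rewrite (big_pred1 (w ord0)) // => l; rewrite andbT eq_sym.
pose cons_w (w : {ffun 'I_m.+1 -> 'I_n}) : {ffun 'I_m.+2 -> 'I_n} :=
  [ffun t => if unlift ord0 t is Some t' then w t' else i].
pose tail_w (w : {ffun 'I_m.+2 -> 'I_n}) : {ffun 'I_m.+1 -> 'I_n} :=
  [ffun t => w (lift ord0 t)].
have cons0 w : cons_w w ord0 = i by rewrite ffunE unlift_none.
have consS w t : cons_w w (lift ord0 t) = w t by rewrite ffunE liftK.
have lmax : (ord_max : 'I_m.+2) = lift ord0 (ord_max : 'I_m.+1) by apply: val_inj.
rewrite [RHS](reindex_onto cons_w tail_w) /=; last first.
  move=> w /andP[/eqP e _]; apply/ffunP => t; rewrite ffunE.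
  by case: unliftP => [t'|] ->; rewrite ?ffunE.
apply: eq_big => [w|w _].
  rewrite cons0 eqxx lmax consS /=.
  suff -> : tail_w (cons_w w) == w by rewrite andbT.
  by apply/eqP/ffunP => t; rewrite ffunE consS.
have srcS (t : 'I_m) : src (lift ord0 t) = lift ord0 (src t) by apply: val_inj.
have src0 : src (ord0 : 'I_m.+1) = ord0 by apply: val_inj.
rewrite [RHS]big_ord_recl src0 cons0 /tgt consS; congr (_ * _).
by apply: eq_bigr => t _; rewrite srcS !consS.
Qed.

Lemma mxtrace_walks (F : realFieldType) n m (A : 'M[F]_n) :
  \tr (A ^+ m) = \sum_(w : {ffun 'I_m.+1 -> 'I_n} | w ord0 == w ord_max)
    \prod_(t < m) A (w (src t)) (w (tgt t)).
Proof.
rewrite /mxtrace (eq_bigr _ (fun i _ => mxpow_walks m A i i)).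
rewrite (exchange_big_dep (fun w : {ffun 'I_m.+1 -> 'I_n} => w ord0 == w ord_max)) /=; last first.
  by move=> i w _ /andP[/eqP -> /eqP ->].
apply: eq_bigr => w /eqP e; rewrite (big_pred1 (w ord0)) // => i.
by rewrite -e andbb eq_sym.
Qed.

Definition loopless m (T : eqType) (w : {ffun 'I_m.+1 -> T}) :=
  [forall t, w (src t) != w (tgt t)].

(** Equality of undirected edges, written with equalities of vertices only. The ordered pair
    [walk_edge] would depend on the numbering of the vertices, whereas goodness of a walk has to be
    a property of its kernel. *)
Definition same_step m (T : eqType) (w : {ffun 'I_m.+1 -> T}) s t :=
  (w (src s) == w (src t)) && (w (tgt s) == w (tgt t)) ||
  (w (src s) == w (tgt t)) && (w (tgt s) == w (src t)).

Definition good_walk m (T : eqType) (w : {ffun 'I_m.+1 -> T}) :=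
  [&& w ord0 == w ord_max, loopless w &
      [forall t, exists s, (s != t) && same_step w s t]].

Lemma good_walk_kernel m (T U : eqType) (w : {ffun 'I_m.+1 -> T}) (u : {ffun 'I_m.+1 -> U}) :
  same_kernel w u -> good_walk w = good_walk u.
Proof.
move=> /same_kernelP H; rewrite /good_walk /loopless /same_step H; congr [&& _, _ & _].
  by apply: eq_forallb => t; rewrite H.
by apply: eq_forallb => t; apply: eq_existsb => s; rewrite !H.
Qed.

Definition walk_edge m n (w : {ffun 'I_m.+1 -> 'I_n}) (t : 'I_m) : nat * nat :=
  edge (w (src t)) (w (tgt t)).

Definition mult m n (w : {ffun 'I_m.+1 -> 'I_n}) (e : nat * nat) : nat :=
  #|[pred t | walk_edge w t == e]|.

Lemma walk_edge_same m n (w : {ffun 'I_m.+1 -> 'I_n}) s t :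
  (walk_edge w s == walk_edge w t) = same_step w s t.
Proof. by rewrite /walk_edge edge_eq /same_step -!(inj_eq val_inj). Qed.

Lemma walk_edge_pairs m n (w : {ffun 'I_m.+1 -> 'I_n}) t :
  loopless w -> walk_edge w t \in pairs n.
Proof. by move=> /forallP/(_ t); rewrite edge_pairs. Qed.

Lemma mult_gt0 m n (w : {ffun 'I_m.+1 -> 'I_n}) t : (0 < mult w (walk_edge w t))%N.
Proof. by apply/card_gt0P; exists t; rewrite inE. Qed.

Lemma good_mult m n (w : {ffun 'I_m.+1 -> 'I_n}) e : good_walk w -> mult w e != 1%N.
Proof.
case/and3P=> _ _ /forallP H; apply/negP => /eqP H1.
have /card_gt0P[t] : (0 < mult w e)%N by rewrite H1.
rewrite inE => /eqP te.
have /existsP[s /andP[st]] := H t; rewrite -walk_edge_same te => se.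
suff : (1 < mult w e)%N by rewrite H1.
rewrite /mult (cardD1 t) !inE te eqxx ltnS; apply/card_gt0P; exists s.
by rewrite !inE st.
Qed.

Lemma bad_mult m n (w : {ffun 'I_m.+1 -> 'I_n}) :
  w ord0 == w ord_max -> loopless w -> ~~ good_walk w ->
  exists2 t, walk_edge w t \in pairs n & mult w (walk_edge w t) = 1%N.
Proof.
rewrite /good_walk => -> wl; rewrite wl /= => /forallPn[t /existsPn Ht].
exists t; first exact: walk_edge_pairs.
rewrite /mult -(card1 t); apply: eq_card => s; rewrite !inE.
have := Ht s; rewrite -walk_edge_same negb_and negbK.
by case: (eqVneq s t) => [->|_] /=; [rewrite eqxx | move/negbTE].
Qed.

(* Distinct vertices other than the start are first reached through distinct edges. *)
Lemma card_firsts_le m n (w : {ffun 'I_m.+1 -> 'I_n}) : loopless w ->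
  (#|firsts w| <= (count (fun e => 0 < mult w e) (pairs n)).+1)%N.
Proof.
move=> wl; pose S := [set t : 'I_m | tgt t \in firsts w].
have sub : firsts w \subset ord0 |: [set tgt t | t in S].
  apply/subsetP => t; case: (unliftP ord0 t) => [s|] -> Hs; rewrite in_setU1 ?eqxx //.
  by apply/orP; right; apply/imsetP; exists s => //; move: Hs; rewrite !inE.
apply: leq_trans (subset_leq_card sub) _.
rewrite cardsU1; apply: leq_trans (leq_add (leq_b1 _) (leqnn _)) _; rewrite add1n ltnS.
rewrite card_imset; last exact: lift_inj.
rewrite -size_filter cardE -(size_map (walk_edge w)); apply: uniq_leq_size.
  rewrite map_inj_in_uniq ?enum_uniq // => s t; rewrite !mem_enum !inE.
  move=> /forallP Hs /forallP Ht /eqP; rewrite walk_edge_same.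
  wlog st : s t Hs Ht / (s <= t)%N.
    move=> W; case: (leqP s t) => [|/ltnW] le; first exact: W.
    move=> H; apply/esym; apply: W => //; move: H.
    by rewrite -!walk_edge_same eq_sym.
  (* If steps [s < t] used the same edge, [tgt t] would already have been visited at one end of step
     [s], and would not be a first visit. *)
  move=> H; apply: val_inj; apply/eqP; rewrite eqn_leq st leqNgt; apply/negP => lt.
  case/orP: H => /andP[/eqP e1 /eqP e2].
    have := Ht (tgt s); rewrite e2 eqxx implybF /= => /negP; apply.
    by rewrite /bump !leq0n !add1n ltnS.
  have := Ht (src s); rewrite e1 eqxx implybF /= => /negP; apply.
  by rewrite /bump leq0n add1n ltnS; exact: st.
move=> e /mapP[t _ ->]; rewrite mem_filter mult_gt0 /=.
exact: walk_edge_pairs.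
Qed.

Definition symX (F : realFieldType) n (vl : nat * nat -> bool -> F)
  (g : nat -> nat -> bool) : 'M[F]_n :=
  \matrix_(i, j) if i == j then 0 else
    let e := edge i j in vl e (g e.1 e.2).

Definition moment (F : realFieldType) (om : nat -> nat -> F) (vl : nat * nat -> bool -> F)
  (e : nat * nat) (k : nat) : F :=
  om e.1 e.2 * vl e true ^+ k + (1 - om e.1 e.2) * vl e false ^+ k.

(** Grouping the steps of the walk by edge turns the product along the walk into one over edges, to
    which independence applies. *)
Lemma Ex_walk (F : realFieldType) n m om vl g0 (w : {ffun 'I_m.+1 -> 'I_n}) :
  Ex (pairs n) om g0 (fun g => \prod_(t < m) symX n vl g (w (src t)) (w (tgt t))) =
  if loopless w then \prod_(e <- pairs n) @moment F om vl e (mult w e) else 0.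
Proof.
case: ifPn => [wl|/forallPn[t]]; last first.
  rewrite negbK => /eqP e; rewrite -[RHS](Ex_cst (pairs n) om g0); apply: Ex_ext => g.
  by rewrite (bigD1 t) //= mxE e eqxx mul0r.
pose h e b : F := vl e b ^+ mult w e.
rewrite -(Ex_prod om g0 h (uniq_pairs n)); apply: Ex_ext => g.
transitivity (\prod_(t < m) \prod_(e <- pairs n | e == walk_edge w t) vl e (g e.1 e.2)).
  apply: eq_bigr => t _.
  rewrite big_mkcond (bigD1_seq (walk_edge w t)) ?walk_edge_pairs ?uniq_pairs //=.
  rewrite eqxx big1 ?mulr1; last by move=> e /negbTE ->.
  by rewrite mxE (negbTE (forallP wl t)).
rewrite (exchange_big_dep predT) //=; apply: eq_bigr => e _.
rewrite prodr_const /h; congr (_ ^+ _).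
by apply: eq_card => t; rewrite !inE eq_sym.
Qed.

Lemma prodr_count (F : realFieldType) (T : Type) (l : seq T) (P : pred T) (p : F) :
  \prod_(e <- l) (if P e then p else 1) = p ^+ count P l.
Proof.
elim: l => [|x l IH]; first by rewrite big_nil.
by rewrite big_cons IH /=; case: (P x); rewrite ?exprS ?mul1r.
Qed.

Lemma moment0 (F : realFieldType) om vl e : @moment F om vl e 0 = 1.
Proof. by rewrite /moment !expr0; ring. Qed.

(** A good walk with [v] vertices uses at least [v - 1] edges, each contributing at most [p]. The
    extra factor [p] on the left completes this to [p ^+ v], the weight that suits the comparison of
    kernels. *)
Lemma Ex_trace_le (F : realFieldType) n m om vl g0 (p : F) :
  0 <= p <= 1 ->
  (forall e, e \in pairs n -> moment om vl e 1 = 0) ->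
  (forall e k, e \in pairs n -> (2 <= k)%N -> `|moment om vl e k| <= p) ->
  p * Ex (pairs n) om g0 (fun g => \tr (symX n vl g ^+ m)) <=
  \sum_(w : {ffun 'I_m.+1 -> 'I_n} | good_walk w) p ^+ #|firsts w|.
Proof.
move=> /andP[p0 p1] m1 m2.
rewrite (Ex_ext _ _ _ (fun g => mxtrace_walks m (symX n vl g))) Ex_sum mulr_sumr.
rewrite [leRHS]big_mkcond [leRHS](bigID (fun w : {ffun 'I_m.+1 -> 'I_n} => w ord0 == w ord_max)) /=.
rewrite [X in _ <= _ + X]big1 ?addr0; last by move=> w /negbTE; rewrite /good_walk => ->.
apply: ler_sum => w wc; rewrite Ex_walk.
have ge0 : 0 <= if good_walk w then p ^+ #|firsts w| else 0.
  by case: ifP => // _; exact: exprn_ge0.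
case: ifPn => wl; last by rewrite mulr0.
case: ifPn => wg; last first.
  have [t tp t1] := bad_mult wc wl wg.
  by rewrite (big_rem _ tp) /= t1 m1 // mul0r mulr0.
have v0 : (0 < #|firsts w|)%N.
  by apply/card_gt0P; exists ord0; rewrite inE; apply/forallP.
rewrite -(prednK v0) exprS ler_wpM2l //; apply: le_trans (ler_norm _) _.
rewrite normr_prod; apply: (@le_trans _ _ (\prod_(e <- pairs n) if (0 < mult w e)%N then p else 1)).
  rewrite big_seq [leRHS]big_seq; apply: ler_prod => e ep; rewrite normr_ge0 /=.
  case: ifPn => H; first by apply: m2 => //; have := good_mult e wg; lia.
  by move: H; rewrite -eqn0Ngt => /eqP ->; rewrite moment0 normr1.
rewrite prodr_count; apply: ler_wiXn2l => //.
by have := card_firsts_le wl; lia.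
Qed.

(** On a good walk every multiplicity is 0 or at least 2, so each factor is at least 1; every other
    closed walk contributes 0, so nothing cancels. *)
Lemma Ex_trace_ge (F : realFieldType) n m om vl g0 :
  (forall e, e \in pairs n -> moment om vl e 1 = 0) ->
  (forall e k, e \in pairs n -> (2 <= k)%N -> 1 <= @moment F om vl e k) ->
  \sum_(w : {ffun 'I_m.+1 -> 'I_n} | good_walk w) 1 <=
  Ex (pairs n) om g0 (fun g => \tr (symX n vl g ^+ m)).
Proof.
move=> m1 m2.
rewrite (Ex_ext _ _ _ (fun g => mxtrace_walks m (symX n vl g))) Ex_sum.
rewrite [leLHS]big_mkcond [leLHS](bigID (fun w : {ffun 'I_m.+1 -> 'I_n} => w ord0 == w ord_max)) /=.
rewrite [X in _ + X <= _]big1 ?addr0; last by move=> w /negbTE; rewrite /good_walk => ->.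
apply: ler_sum => w wc; rewrite Ex_walk.
case: (boolP (good_walk w)) => wg.
  have /and3P[_ -> _] := wg.
  rewrite big_seq; elim/big_ind : _ => // [x y x1 y1|e ep]; first exact: mulr_ege1.
  case E : (mult w e) (good_mult e wg) => [|[|k]] // _; last exact: m2.
  by rewrite moment0.
case: ifPn => wl //.
have [t tp t1] := bad_mult wc wl wg.
by rewrite (big_rem _ tp) /= t1 m1 // mul0r.
Qed.

(* [r] of the order of [n * p] suffices, so a sparse matrix of size [n] is compared with
   a dense one of much smaller size. *)
Lemma Ex_trace_comparison (F : realFieldType) n r m om vl g0 om' vl' g0' (p : F) :
  0 <= p <= 1 -> (2 * m.+1 <= r)%N -> 2 * (n%:R * p) <= r%:R ->
  (forall e, e \in pairs n -> moment om vl e 1 = 0) ->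
  (forall e k, e \in pairs n -> (2 <= k)%N -> `|moment om vl e k| <= p) ->
  (forall e, e \in pairs r -> moment om' vl' e 1 = 0) ->
  (forall e k, e \in pairs r -> (2 <= k)%N -> 1 <= moment om' vl' e k) ->
  p * Ex (pairs n) om g0 (fun g => \tr (symX n vl g ^+ m)) <=
  Ex (pairs r) om' g0' (fun g => \tr (symX r vl' g ^+ m)).
Proof.
move=> p01 mr npr m1 m2 m1' m2'.
apply: le_trans (Ex_trace_le m g0 p01 m1 m2) _.
apply: le_trans (Ex_trace_ge m g0' m1' m2').
have /andP[p0 _] := p01.
apply: kernel_comparison => // w u; exact: good_walk_kernel.
Qed.

(** * Quadratic forms and lattice points *)

Definition nrm2 (F : realFieldType) n (x : 'I_n -> F) : F := \sum_i x i ^+ 2.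
Definition bil (F : realFieldType) n (M : 'M[F]_n) (x y : 'I_n -> F) : F :=
  \sum_i \sum_j x i * M i j * y j.
Definition app (F : realFieldType) n (M : 'M[F]_n) (x : 'I_n -> F) : 'I_n -> F :=
  fun i => \sum_j M i j * x j.

Lemma nrm2_ge0 (F : realFieldType) n (x : 'I_n -> F) : 0 <= nrm2 x.
Proof. by apply: sumr_ge0 => i _; exact: sqr_ge0. Qed.

Lemma bil_app (F : realFieldType) n (M : 'M[F]_n) x y :
  bil M x y = \sum_i x i * app M y i.
Proof.
apply: eq_bigr => i _; rewrite mulr_sumr; apply: eq_bigr => j _; by rewrite mulrA.
Qed.

Lemma app_norm_le (F : rcfType) n (M : 'M[F]_n) (rho L : F) :
  0 < rho -> 0 <= L ->
  (forall x y, nrm2 x <= rho -> nrm2 y <= rho -> bil M x y <= rho * L) ->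
  forall x, nrm2 (app M x) <= L ^+ 2 * nrm2 x.
Proof.
move=> rho0 L0 H x.
have nZ c (y : 'I_n -> F) : nrm2 (fun i => c * y i) = c ^+ 2 * nrm2 y.
  by rewrite /nrm2 mulr_sumr; apply: eq_bigr => i _; rewrite exprMn.
set y := app M x.
have [y0|] := eqVneq (nrm2 y) 0; first by rewrite y0 mulr_ge0 ?sqr_ge0 ?nrm2_ge0.
move=> yn0; have yp : 0 < nrm2 y by rewrite lt_def yn0 nrm2_ge0.
have [x0|xn0] := eqVneq (nrm2 x) 0.
  suff : nrm2 y = 0 by move=> e; rewrite e eqxx in yn0.
  apply: big1 => i _; rewrite /y /app big1 ?expr0n // => j _.
  have /eqP := x0; rewrite psumr_eq0; last by move=> l _; exact: sqr_ge0.
  by move=> /allP/(_ j (mem_index_enum j)); rewrite sqrf_eq0 => /eqP ->; rewrite mulr0.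
have xp : 0 < nrm2 x by rewrite lt_def xn0 nrm2_ge0.
pose a := Num.sqrt (rho / nrm2 x); pose b := Num.sqrt (rho / nrm2 y).
have a2 : a ^+ 2 = rho / nrm2 x by rewrite sqr_sqrtr // divr_ge0 // ltW.
have b2 : b ^+ 2 = rho / nrm2 y by rewrite sqr_sqrtr // divr_ge0 // ltW.
have ab0 : 0 <= b * a by rewrite mulr_ge0 ?sqrtr_ge0.
have := H (fun i => b * y i) (fun i => a * x i).
rewrite !nZ a2 b2 !mulfVK // => /(_ (lexx _) (lexx _)).
have -> : bil M (fun i => b * y i) (fun i => a * x i) = b * a * nrm2 y.
  rewrite bil_app mulr_sumr; apply: eq_bigr => i _.
  have -> : app M (fun i => a * x i) i = a * y i.
    by rewrite /y /app mulr_sumr; apply: eq_bigr => j _; ring.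
  by ring.
move=> le.
have : (b * a * nrm2 y) ^+ 2 <= (rho * L) ^+ 2.
  apply: lerXn2r => //; rewrite nnegrE; first exact: mulr_ge0 ab0 (nrm2_ge0 _).
  exact: mulr_ge0 (ltW rho0) L0.
rewrite !exprMn a2 b2.
have -> : rho / nrm2 y * (rho / nrm2 x) * nrm2 y ^+ 2 = rho ^+ 2 * (nrm2 y / nrm2 x) by field; lra.
rewrite ler_pM2l ?exprn_gt0 // ler_pdivrMr //.
Qed.

Lemma mxpow_sym (F : realFieldType) n (M : 'M[F]_n) k :
  (forall i j, M i j = M j i) -> forall i j, (M ^+ k) i j = (M ^+ k) j i.
Proof.
move=> Ms i j; have e : M^T = M by apply/matrixP => x y; rewrite mxE.
suff e' : (M ^+ k)^T = M ^+ k by rewrite -[in LHS]e' mxE.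
elim: k => [|k IH]; first by rewrite !expr0; exact: trmx1.
by rewrite exprS [M * _]/(M *m _) trmx_mul IH e -[_ *m _]/(_ * _) -exprSr exprS.
Qed.

Lemma mxtrace_sqr (F : realFieldType) n (M : 'M[F]_n) k :
  (forall i j, M i j = M j i) ->
  \tr (M ^+ (2 * k)) = \sum_i nrm2 (fun j => (M ^+ k) j i).
Proof.
move=> Ms; apply: eq_bigr => i _.
rewrite mul2n -addnn exprD mxE; apply: eq_bigr => j _.
by rewrite (mxpow_sym _ Ms i j) expr2.
Qed.

(** The trace is the sum of the squared norms of the columns of [M ^+ k], and each application of
    [M] costs a factor [L ^+ 2]. *)
Lemma trace_le_norm (F : realFieldType) n (M : 'M[F]_n) (L : F) k :
  (forall i j, M i j = M j i) -> 0 <= L ->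
  (forall x, nrm2 (app M x) <= L ^+ 2 * nrm2 x) ->
  \tr (M ^+ (2 * k)) <= n%:R * L ^+ (2 * k).
Proof.
move=> Ms L0 H; rewrite mxtrace_sqr //.
apply: (@le_trans _ _ (\sum_(i < n) L ^+ (2 * k))); last first.
  by rewrite sumr_const card_ord mulr_natl.
apply: ler_sum => i _; elim: k => [|k IH].
  rewrite muln0 !expr0 /nrm2 (bigD1 i) //= mxE eqxx expr1n big1 ?addr0 // => j /negbTE ji.
  by rewrite mxE ji expr0n.
have -> : nrm2 (fun j => (M ^+ k.+1) j i) = nrm2 (app M (fun j => (M ^+ k) j i)).
  by apply: eq_bigr => j _; rewrite [M ^+ k.+1]exprS mxE.
apply: le_trans (H _) _.
by rewrite mulnS exprD ler_wpM2l // exprn_ge0.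
Qed.

(** Of the two integers enclosing [x], the linear form with slope [c] favours one. Its modulus is at
    most [|x| + 1], whose square is at most [2 * x ^+ 2 + 2]. *)
Lemma round_coord (F : archiRealFieldType) (c x : F) :
  exists (b : bool) (m : nat), c * x <= c * ((-1) ^+ b * m%:R) /\ m%:R ^+ 2 <= 2 * x ^+ 2 + 2.
Proof.
have [m /andP[m1 m2]] : exists m : nat, m%:R <= `|x| < m.+1%:R.
  by exists (Num.truncn `|x|); exact: truncn_itv.
have [b xb] : exists b : bool, x = (-1) ^+ b * `|x|.
  by exists (x < 0)%R; rewrite {1}[x]realEsign ?num_real.
set y := `|x| in m1 m2 xb.
have x2 : x ^+ 2 = y ^+ 2 by rewrite xb exprMn sqrr_sign mul1r.
have y0 : 0 <= y by exact: normr_ge0.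
have m0 : 0 <= m%:R :> F by exact: ler0n.
rewrite -natr1 in m2.
case: (lerP 0 (c * (-1) ^+ b)) => cs.
  exists b, m.+1; rewrite x2 xb !mulrA -natr1; split.
    by rewrite ler_wpM2l // ltW.
  have H : (m%:R + 1) ^+ 2 <= (y + 1) ^+ 2 by apply: lerXn2r; rewrite ?nnegrE; lra.
  apply: le_trans H _; have := sqr_ge0 (y - 1); nra.
exists b, m; rewrite x2 xb !mulrA; split.
  by rewrite ler_wnM2l // ltW.
have H : m%:R ^+ 2 <= y ^+ 2 by apply: lerXn2r; rewrite ?nnegrE; lra.
by have := sqr_ge0 y; lra.
Qed.

(** Sign and modulus of each coordinate; bounding the modulus by [n + 1] makes the type finite. Zero
    has two codes, which is harmless for upper bounds. *)
Definition lat_idx (n : nat) := {ffun 'I_n -> bool * 'I_n.+2}.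

Definition lat (F : realFieldType) n (z : lat_idx n) : 'I_n -> F :=
  fun i => (-1) ^+ (z i).1 * (z i).2%:R.

(** Rounding a vector of squared norm at most [n] gives at most [2 * n + 2 * n], whence the 4. *)
Definition lat_ball n (z : lat_idx n) : bool := (\sum_i (z i).2 ^ 2 <= 4 * n)%N.

Lemma nrm2_lat (F : realFieldType) n (z : lat_idx n) :
  nrm2 (lat F z) = (\sum_i (z i).2 ^ 2)%:R.
Proof.
rewrite natr_sum; apply: eq_bigr => i _.
by rewrite /lat exprMn sqrr_sign mul1r natrX.
Qed.

Lemma lat_ball_norm (F : realFieldType) n (z : lat_idx n) :
  lat_ball z = (nrm2 (lat F z) <= 4 * n%:R).
Proof. by rewrite nrm2_lat -[4]/(4%:R) -natrM ler_nat. Qed.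

(* A linear form on a unit cube is maximal at a vertex. *)
Lemma round_vec (F : archiRealFieldType) n (c x : 'I_n -> F) :
  nrm2 x <= n%:R ->
  exists z : lat_idx n, lat_ball z /\ \sum_i c i * x i <= \sum_i c i * lat F z i.
Proof.
move=> xn.
have xi i : x i ^+ 2 <= n%:R.
  apply: le_trans xn; rewrite /nrm2 (bigD1 i) //= lerDl.
  by apply: sumr_ge0 => j _; exact: sqr_ge0.
have H i : exists bm : bool * 'I_n.+2,
    (c i * x i <= c i * ((-1) ^+ bm.1 * bm.2%:R)) && (bm.2%:R ^+ 2 <= 2 * x i ^+ 2 + 2).
  have [b [m [H1 H2]]] := round_coord (c i) (x i).
  have mn : (m < n.+2)%N.
    rewrite ltnS -(@leq_exp2r _ _ 2) // -(ler_nat F) natrX.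
    apply: le_trans H2 _; have := xi i; rewrite natrX -natr1.
    have : 1 <= n%:R :> F by rewrite ler1n; exact: leq_ltn_trans (ltn_ord i).
    nra.
  by exists (b, Ordinal mn); rewrite H1 H2.
pose z : lat_idx n := [ffun i => xchoose (H i)].
have zP i := xchooseP (H i).
exists z; split.
  rewrite (lat_ball_norm F); apply: (@le_trans _ _ (\sum_i (2 * x i ^+ 2 + 2))).
    apply: ler_sum => i _; rewrite /lat exprMn sqrr_sign mul1r ffunE.
    by have /andP[_] := zP i.
  rewrite big_split /= -mulr_sumr sumr_const card_ord -mulr_natl.
  move: xn; rewrite /nrm2; nra.
by apply: ler_sum => i _; rewrite /lat ffunE; have /andP[] := zP i.
Qed.

(** In the ball the moduli sum to at most [4 * n], since [m <= m ^ 2] for naturals, so the weight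
    [2 ^ (4 * n)] times the product of the [2 ^ (- m_i)] is at least 1 there. Summed over all
    points, each coordinate yields at most 2 signs times a geometric sum of 2, and [16 * 4 = 64]. *)
Lemma card_lat_ball n : (#|[pred z : lat_idx n | lat_ball z]| <= 64 ^ n)%N.
Proof.
rewrite -(ler_nat rat) natrX.
apply: (@le_trans _ _ (\sum_(z : lat_idx n) 2 ^+ (4 * n) * \prod_i (2^-1) ^+ (z i).2)).
  rewrite -sum1_card natr_sum big_mkcond /=; apply: ler_sum => z _.
  have ge0 : 0 <= \prod_i (2^-1 : rat) ^+ (z i).2.
    by apply: prodr_ge0 => i _; rewrite exprn_ge0 // invr_ge0.
  case: ifP => H; last by rewrite mulr_ge0 // exprn_ge0.
  rewrite -expr_sum exprVn -(ler_pM2r (x := 2 ^+ (\sum_i (z i).2))) ?exprn_gt0 // mul1r mulfVK ?expf_neq0 //.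
  apply: ler_weXn2l => //; apply: leq_trans H; apply: leq_sum => i _.
  by case: (nat_of_ord _) => // k; rewrite -mulnn leq_pmulr.
rewrite -mulr_sumr -(bigA_distr_bigA (fun (i : 'I_n) (bm : bool * 'I_n.+2) => (2^-1 : rat) ^+ bm.2)) /=.
rewrite prodr_const card_ord exprM -exprMn; apply: lerXn2r; rewrite ?nnegrE //.
  by rewrite mulr_ge0 ?exprn_ge0 // sumr_ge0 // => bm _; rewrite exprn_ge0 // invr_ge0.
rewrite -(pair_bigA _ (fun (b : bool) (m : 'I_n.+2) => (2^-1 : rat) ^+ m)) /= sumr_const card_bool.
have geo N : \sum_(m < N) (2^-1 : rat) ^+ m <= 2.
  suff -> : \sum_(m < N) (2^-1 : rat) ^+ m = 2 - 2 * 2^-1 ^+ N.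
    by rewrite lerBlDr lerDl mulr_ge0 // exprn_ge0 // invr_ge0.
  elim: N => [|N IH]; first by rewrite big_ord0 expr0; lra.
  by rewrite big_ord_recr /= IH exprS; field.
by have := geo n.+2; rewrite -mulr_natl; lra.
Qed.

(** The largest value of [bil] on pairs of lattice points controls the operator norm. Bounding the
    even power of this maximum by the sum of all even powers gives a quantity whose expectation is
    computed term by term. *)
Lemma trace_le_lattice (F : realType) n (M : 'M[F]_n) k :
  (0 < n)%N -> (forall i j, M i j = M j i) ->
  n%:R ^+ (2 * k) * \tr (M ^+ (2 * k)) <=
  n%:R * \sum_(z : lat_idx n | lat_ball z) \sum_(z' : lat_idx n | lat_ball z')
    bil M (lat F z) (lat F z') ^+ (2 * k).
Proof.
move=> n0 Ms.
pose z0 : lat_idx n := [ffun=> (false, ord0)].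
have z0b : lat_ball z0 by rewrite /lat_ball big1 // => i _; rewrite ffunE.
pose P (zz : lat_idx n * lat_idx n) := lat_ball zz.1 && lat_ball zz.2.
have P0 : P (z0, z0) by rewrite /P /= z0b.
case: (arg_maxP (fun zz => bil M (lat F zz.1) (lat F zz.2)) P0) => -[z1 z2] /= Pz zmax.
set B := bil M (lat F z1) (lat F z2).
have B0 : 0 <= B.
  apply: le_trans (zmax _ P0); rewrite /bil big1 // => i _; rewrite big1 // => j _.
  by rewrite /lat !ffunE /= mulr0 !mul0r.
have n0' : 0 < n%:R :> F by rewrite ltr0n.
have bilC x y : bil M x y = bil M y x.
  rewrite /bil exchange_big; apply: eq_bigr => i _; apply: eq_bigr => j _.
  by rewrite (Ms i j); ring.
(* One vector is rounded at a time: [x] against the fixed [y], then [y] against the already rounded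
   [z]. *)
have up x y : nrm2 x <= n%:R -> nrm2 y <= n%:R -> bil M x y <= n%:R * (B / n%:R).
  move=> xn yn; rewrite mulrC mulfVK ?gt_eqF //.
  have [z [zb zle]] := round_vec (app M y) xn.
  have [z' [zb' zle']] := round_vec (app M (lat F z)) yn.
  apply: le_trans (zmax (z, z') _); last by rewrite /P zb zb'.
  apply: (@le_trans _ _ (bil M (lat F z) y)).
    rewrite !bil_app; apply: le_trans (le_trans _ zle) _; rewrite le_eqVlt; apply/orP; left; apply/eqP.
      by apply: eq_bigr => i _; rewrite mulrC.
    by apply: eq_bigr => i _; rewrite mulrC.
  rewrite bilC [leRHS]bilC !bil_app; apply: le_trans (le_trans _ zle') _; rewrite le_eqVlt; apply/orP; left; apply/eqP.
    by apply: eq_bigr => i _; rewrite mulrC.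
  by apply: eq_bigr => i _; rewrite mulrC.
have L0 : 0 <= B / n%:R by rewrite divr_ge0 // ltW.
have := trace_le_norm k Ms L0 (app_norm_le n0' L0 up).
rewrite -(ler_pM2l (x := n%:R ^+ (2 * k))) ?exprn_gt0 // mulrCA -exprMn.
have -> : n%:R * (B / n%:R) = B by rewrite mulrC mulfVK ?gt_eqF.
move=> H; apply: le_trans H _; rewrite ler_wpM2l ?ler0n //.
have /andP[/= b1 b2] := Pz.
have ev x : 0 <= x ^+ (2 * k) :> F by rewrite mulnC exprM sqr_ge0.
rewrite (bigD1 z1) //= (bigD1 z2) //= -/B -addrA lerDl.
by rewrite addr_ge0 // sumr_ge0 // => z _; rewrite sumr_ge0.
Qed.

(** * Dense random matrices *)

Lemma big_pairs (F : realFieldType) n (G : nat -> nat -> F) :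
  \sum_(e <- pairs n) G e.1 e.2 = \sum_(i < n) \sum_(j < n | (i < j)%N) G i j.
Proof.
have E k : iota 0 k = index_iota 0 k by rewrite /index_iota subn0.
rewrite pairsE big_allpairs_dep /= E big_mkord.
rewrite (eq_bigr (fun j : 'I_n => \sum_(i < n | (i < j)%N) G i j)); last first.
  by move=> j _; rewrite E big_mkord (big_ord_widen n (fun i => G i j)) // ltnW.
by rewrite (exchange_big_dep predT).
Qed.

Lemma sum_offdiag (F : realFieldType) n (T : 'I_n -> 'I_n -> F) :
  (forall i, T i i = 0) ->
  \sum_i \sum_j T i j = \sum_(i < n) \sum_(j < n | (i < j)%N) (T i j + T j i).
Proof.
move=> T0; rewrite (eq_bigr (fun i : 'I_n => \sum_(j < n | (i < j)%N) T i j +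
    \sum_(j < n | ~~ (i < j)%N) T i j)); last by move=> i _; rewrite (bigID (fun j : 'I_n => (i < j)%N)).
rewrite big_split /= [X in _ + X](exchange_big_dep predT) //= -big_split /=.
apply: eq_bigr => i _; rewrite big_split /=; congr (_ + _).
rewrite (bigD1 i) ?ltnn //= T0 add0r; apply: eq_bigl => j.
by rewrite -leqNgt ltn_neqAle andbC -(inj_eq val_inj) eq_sym.
Qed.

Definition ext (F : realFieldType) n (x : 'I_n -> F) (i : nat) : F :=
  if insub i is Some j then x j else 0.

Lemma extE (F : realFieldType) n (x : 'I_n -> F) (i : 'I_n) : ext x i = x i.
Proof. by rewrite /ext valK. Qed.

(** Coefficient of the random variable of edge [e] in [bil], both orientations included. *)
Definition cross (F : realFieldType) n (x y : 'I_n -> F) (e : nat * nat) : F :=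
  ext x e.1 * ext y e.2 + ext x e.2 * ext y e.1.

Lemma bil_symX (F : realFieldType) n vl g (x y : 'I_n -> F) :
  bil (symX n vl g) x y = \sum_(e <- pairs n) vl e (g e.1 e.2) * cross x y e.
Proof.
rewrite (eq_bigr (fun e => vl (e.1, e.2) (g e.1 e.2) * cross x y (e.1, e.2))); last by case.
rewrite (big_pairs n (fun i j => vl (i, j) (g i j) * cross x y (i, j))) /bil sum_offdiag.
  apply: eq_bigr => i _; apply: eq_bigr => j ij.
  have nij : (i == j) = false by apply/negbTE; rewrite -(inj_eq val_inj) ltn_eqF.
  have nji : (j == i) = false by rewrite eq_sym.
  rewrite !mxE nij nji (edgeC j i) /edge (minn_idPl (ltnW ij)) (maxn_idPr (ltnW ij)).
  by rewrite /cross !extE /=; ring.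
by move=> i; rewrite mxE eqxx; ring.
Qed.

Lemma sum_cross_sqr (F : realFieldType) n (x y : 'I_n -> F) :
  \sum_(e <- pairs n) cross x y e ^+ 2 <= 2 * (nrm2 x * nrm2 y).
Proof.
rewrite (eq_bigr (fun e => cross x y (e.1, e.2) ^+ 2)); last by case.
rewrite (big_pairs n (fun i j => cross x y (i, j) ^+ 2)).
pose T (i j : 'I_n) := if i == j then 0 else x i ^+ 2 * y j ^+ 2.
have T2 : \sum_i \sum_j T i j <= nrm2 x * nrm2 y.
  rewrite /nrm2 mulr_suml; apply: ler_sum => i _; rewrite mulr_sumr; apply: ler_sum => j _.
  by rewrite /T; case: ifP => // _; rewrite mulr_ge0 ?sqr_ge0.
apply: le_trans (ler_wpM2l _ T2) => //; rewrite sum_offdiag; last by move=> i; rewrite /T eqxx.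
rewrite mulr_sumr; apply: ler_sum => i _; rewrite mulr_sumr; apply: ler_sum => j ij.
have nij : (i == j) = false by apply/negbTE; rewrite -(inj_eq val_inj) ltn_eqF.
  have nji : (j == i) = false by rewrite eq_sym.
rewrite /T nij nji /cross !extE /=.
rewrite -subr_ge0.
have -> : 2 * (x i ^+ 2 * y j ^+ 2 + x j ^+ 2 * y i ^+ 2) - (x i * y j + x j * y i) ^+ 2 =
  (x i * y j - x j * y i) ^+ 2 by ring.
exact: sqr_ge0.
Qed.

Lemma exp_ge1D (x : R) : 1 + x <= exp x.
Proof. by apply/RleP; exact: exp_ineq1_le. Qed.

Lemma expD (x y : R) : exp (x + y) = exp x * exp y.
Proof. exact: exp_plus. Qed.

Lemma exp_gt0 (x : R) : 0 < exp x.
Proof. by apply/RltP; exact: exp_pos. Qed.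

Lemma exp_ge0 (x : R) : 0 <= exp x.
Proof. exact: ltW (exp_gt0 x). Qed.

Lemma exp_mono (x y : R) : x <= y -> exp x <= exp y.
Proof.
rewrite le_eqVlt => /orP[/eqP -> //|/RltP xy].
by apply/RleP; left; exact: exp_increasing.
Qed.

Lemma exp_sum (T : Type) (l : seq T) (P : pred T) (f : T -> R) :
  exp (\sum_(i <- l | P i) f i) = \prod_(i <- l | P i) exp (f i).
Proof.
apply: (big_morph exp) => [x y|]; last exact: exp_0.
by rewrite expD.
Qed.

(** The linear term cancels in the expectation of a centred variable and leaves a subgaussian bound.
    For [x > 1] already [x <= 2 * x ^+ 2]; otherwise [exp (- x) >= (1 - x / 2) ^+ 2] reduces the
    claim to a polynomial inequality. *)
Lemma exp_quad (x : R) : exp x <= x + exp (2 * x ^+ 2).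
Proof.
have [x1|x1] := lerP x 1; last first.
  apply: (@le_trans _ _ (exp (2 * x ^+ 2))); last by lra.
  by apply: exp_mono; nra.
have H : exp x * exp (- x) = 1 by rewrite -expD subrr expR0.
have H2 : (1 - x / 2) ^+ 2 <= exp (- x).
  have -> : exp (- x) = exp (- x / 2) ^+ 2.
    by rewrite expr2 -expD; congr exp; field.
  have := exp_ge1D (- x / 2) => h.
  by apply: lerXn2r; rewrite ?nnegrE; lra.
have h0 : 0 < (1 - x / 2) ^+ 2 by rewrite exprn_gt0 //; lra.
have H3 : exp x * (1 - x / 2) ^+ 2 <= 1.
  by rewrite -[leRHS]H ler_wpM2l // exp_ge0.
have H4 : 1 <= (1 + x + 2 * x ^+ 2) * (1 - x / 2) ^+ 2.
  have -> : (1 + x + 2 * x ^+ 2) * (1 - x / 2) ^+ 2 =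
    1 + x ^+ 2 * ((1 - x) * (5 / 2 - x) / 2) by field.
  rewrite lerDl; apply: mulr_ge0 (sqr_ge0 x) _; apply: divr_ge0 => //; apply: mulr_ge0; lra.
have : exp x <= 1 + x + 2 * x ^+ 2 by rewrite -(ler_pM2r h0); exact: le_trans H4.
have := exp_ge1D (2 * x ^+ 2); lra.
Qed.

Lemma pow_le_exp (u : R) k : (0 < k)%N -> 0 <= u -> u ^+ k <= k%:R ^+ k * exp u.
Proof.
move=> k0 u0; have kp : 0 < k%:R :> R by rewrite ltr0n.
have -> : exp u = exp (u / k%:R) ^+ k.
  by rewrite expRX -[_ / _ *+ _]mulr_natr mulfVK // gt_eqF.
rewrite -exprMn; apply: lerXn2r => //; first by rewrite nnegrE mulr_ge0 ?exp_ge0.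
apply: (@le_trans _ _ (k%:R * (u / k%:R))); first by rewrite mulrC mulfVK // gt_eqF.
by rewrite ler_wpM2l ?ltW //; have := exp_ge1D (u / k%:R); lra.
Qed.

Lemma even_pow_le_exp (u : R) k : (0 < k)%N ->
  u ^+ (2 * k) <= (2 * k)%:R ^+ (2 * k) * (exp u + exp (- u)).
Proof.
move=> k0; have k2 : (0 < 2 * k)%N by rewrite muln_gt0.
have c0 : 0 <= (2 * k)%:R ^+ (2 * k) :> R by rewrite exprn_ge0.
case: (lerP 0 u) => u0.
  apply: le_trans (pow_le_exp k2 u0) _; rewrite ler_wpM2l //.
  by rewrite lerDl exp_ge0.
have -> : u ^+ (2 * k) = (- u) ^+ (2 * k) by rewrite !exprM sqrrN.
have nu : 0 <= - u by lra.
apply: le_trans (pow_le_exp k2 nu) _; rewrite ler_wpM2l //.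
by rewrite lerDr exp_ge0.
Qed.

(* Symmetric signs would not do: their odd moments vanish, whereas those of the sparse entries do not. *)
Definition skew_om (F : realFieldType) : nat -> nat -> F := fun _ _ => 1 / 3.
Definition skew_vl (F : realFieldType) : nat * nat -> bool -> F :=
  fun _ b => if b then 2 else -1.

Lemma skew_prob (F : realFieldType) l : is_prob l (@skew_om F).
Proof. by move=> e _; rewrite /skew_om; lra. Qed.

Lemma skew_moment1 (F : realFieldType) e : moment (@skew_om F) (@skew_vl F) e 1 = 0.
Proof. by rewrite /moment /skew_om /skew_vl !expr1; field. Qed.

Lemma skew_moment_ge1 (F : realFieldType) e k : (2 <= k)%N ->
  1 <= moment (@skew_om F) (@skew_vl F) e k.
Proof.
case: k => [|[|[|k]]] // _; rewrite /moment /skew_om /skew_vl !exprS.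
  by rewrite !expr0; lra.
have : `|(-1) ^+ k : F| <= 1 by rewrite normrX normrN1 expr1n.
rewrite ler_norml => /andP[].
have : 1 <= 2 ^+ k :> F by rewrite exprn_ege1 // ler1n.
by move: (2 ^+ k) ((-1) ^+ k) => A B; lra.
Qed.

(** The larger value 2 gives [2 * (2 * s * c) ^+ 2 = 8 * s ^+ 2 * c ^+ 2] per edge, and
    [sum_cross_sqr] doubles the 8 into 16. *)
Lemma skew_mgf n g0 (x y : 'I_n -> R) (s : R) :
  Ex (pairs n) (@skew_om R) g0 (fun g => exp (s * bil (symX n (@skew_vl R) g) x y)) <=
  exp (16 * s ^+ 2 * (nrm2 x * nrm2 y)).
Proof.
pose h e b := exp (s * ((@skew_vl R) e b * cross x y e)).
rewrite (Ex_ext _ _ _ (f2 := fun g => \prod_(e <- pairs n) h e (g e.1 e.2))); last first.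
  by move=> g; rewrite bil_symX mulr_sumr exp_sum.
rewrite Ex_prod ?uniq_pairs //.
apply: (@le_trans _ _ (\prod_(e <- pairs n) exp (8 * s ^+ 2 * cross x y e ^+ 2))); last first.
  rewrite -exp_sum; apply: exp_mono; rewrite -mulr_sumr.
  have := sum_cross_sqr x y; have := sqr_ge0 s; nra.
rewrite big_seq [leRHS]big_seq; apply: ler_prod => e _; set c := cross x y e.
rewrite /skew_om /h /skew_vl -/c; apply/andP; split.
  by rewrite addr_ge0 // mulr_ge0 ?exp_ge0 //; lra.
have h1 := exp_quad (s * (2 * c)); have h2 := exp_quad (s * (-1 * c)).
have : exp (2 * (s * (-1 * c)) ^+ 2) <= exp (8 * s ^+ 2 * c ^+ 2).
  by apply: exp_mono; have := sqr_ge0 (s * c); rewrite !exprMn; nra.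
have e1 : 2 * (s * (2 * c)) ^+ 2 = 8 * s ^+ 2 * c ^+ 2 by ring.
rewrite e1 in h1; lra.
Qed.

(** One factor 64 for each of the two lattice points, and the exponential moment: with
    [s ^+ 2 = 1 / r] and squared norms at most [4 * r], the exponent of [skew_mgf] is at most
    [16 * 16 * r]. *)
Definition dense_cst : R := 64 * 64 * exp (16 * 16).

Lemma dense_bound r k g0 : (0 < k)%N -> (0 < r)%N ->
  r%:R ^+ k * Ex (pairs r) (@skew_om R) g0 (fun g => \tr (symX r (@skew_vl R) g ^+ (2 * k))) <=
  2 * r%:R * dense_cst ^+ r * (2 * k)%:R ^+ (2 * k).
Proof.
move=> k0 r0; have rp : 0 < r%:R :> R by rewrite ltr0n.
set c2 := (2 * k)%:R ^+ (2 * k).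
have c20 : 0 <= c2 by rewrite exprn_ge0.
(* At this scale the exponential moment over the ball is exponential in [r], like the number of
   lattice points, so the sum over pairs only changes the constant. *)
pose s : R := Num.sqrt (r%:R^-1).
have s2 : s ^+ 2 = r%:R^-1 by rewrite sqr_sqrtr // invr_ge0 ltW.
have step z z' : lat_ball z -> lat_ball z' ->
    Ex (pairs r) (@skew_om R) g0 (fun g => bil (symX r (@skew_vl R) g) (lat R z) (lat R z') ^+ (2 * k)) <=
    r%:R ^+ k * c2 * (2 * exp (16 * 16) ^+ r).
  rewrite !(lat_ball_norm R) => zb zb'.
  apply: (@le_trans _ _ (Ex (pairs r) (@skew_om R) g0 (fun g => r%:R ^+ k * c2 *
     (exp (s * bil (symX r (@skew_vl R) g) (lat R z) (lat R z')) +
      exp (- s * bil (symX r (@skew_vl R) g) (lat R z) (lat R z')))))).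
    apply: Ex_le => [|g]; first exact: skew_prob.
    set u := bil _ _ _.
    have -> : u ^+ (2 * k) = r%:R ^+ k * (s * u) ^+ (2 * k).
      by rewrite exprMn mulrA (exprM s) s2 exprVn mulfV ?mul1r // expf_neq0 // gt_eqF.
    rewrite -mulrA ler_wpM2l ?exprn_ge0 // mulNr.
    exact: even_pow_le_exp.
  rewrite ExZ ExD ler_wpM2l ?mulr_ge0 ?exprn_ge0 //.
  have m1 := skew_mgf g0 (lat R z) (lat R z') s.
  have m2 := skew_mgf g0 (lat R z) (lat R z') (- s).
  rewrite sqrrN s2 in m2; rewrite s2 in m1.
  have e : exp (16 * r%:R^-1 * (nrm2 (lat R z) * nrm2 (lat R z'))) <= exp (16 * 16) ^+ r.
    rewrite expRX; apply: exp_mono; rewrite -[leRHS]mulr_natr.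
    apply: (@le_trans _ _ (16 * r%:R^-1 * (4 * r%:R * (4 * r%:R)))).
      rewrite ler_wpM2l ?ler_pM ?nrm2_ge0 // mulr_ge0 // invr_ge0 ltW //.
    by rewrite le_eqVlt; apply/orP; left; apply/eqP; field; lra.
  rewrite mulr_natl mulr2n lerD //; first exact: le_trans m1 e.
  exact: le_trans m2 e.
have rk : 0 < r%:R ^+ k :> R by rewrite exprn_gt0.
rewrite -(ler_pM2l rk) mulrA -exprD addnn -mul2n -ExZ.
apply: (@le_trans _ _ (Ex (pairs r) (@skew_om R) g0 (fun g => r%:R *
   \sum_(z : lat_idx r | lat_ball z) \sum_(z' : lat_idx r | lat_ball z')
     bil (symX r (@skew_vl R) g) (lat R z) (lat R z') ^+ (2 * k)))).
  apply: Ex_le => [|g]; first exact: skew_prob.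
  by apply: trace_le_lattice => // i j; rewrite !mxE eq_sym edgeC.
rewrite ExZ Ex_sum.
have -> : r%:R ^+ k * (2 * r%:R * dense_cst ^+ r * c2) =
  r%:R * (64 ^+ r * (64 ^+ r * (r%:R ^+ k * c2 * (2 * exp (16 * 16) ^+ r)))).
  have -> : dense_cst ^+ r = 64 ^+ r * 64 ^+ r * exp (16 * 16) ^+ r.
    by rewrite -!exprMn /dense_cst; congr (_ ^+ _); ring.
  by ring.
apply: (ler_wpM2l (ltW rp)).
have cnt (B : R) (f : lat_idx r -> R) : 0 <= B -> (forall z, lat_ball z -> f z <= B) ->
    \sum_(z | lat_ball z) f z <= 64 ^+ r * B.
  move=> B0 fB; apply: le_trans (ler_sum _ fB) _.
  rewrite sumr_const -[leLHS]mulr_natl ler_wpM2r // -natrX ler_nat.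
  exact: card_lat_ball.
have T0 : 0 <= r%:R ^+ k * c2 * (2 * exp (16 * 16) ^+ r).
  by rewrite !mulr_ge0 ?exprn_ge0 ?exp_ge0.
apply: (cnt) => [|z zb]; first by rewrite mulr_ge0 // exprn_ge0.
by rewrite Ex_sum; apply: (cnt) => // z1 zb1; exact: step.
Qed.

(** * Spectral norm of a sparse centred adjacency matrix *)

Lemma cauchy_schwarz (F : realFieldType) n (x y : 'I_n -> F) :
  (\sum_i x i * y i) ^+ 2 <= nrm2 x * nrm2 y.
Proof.
have : 0 <= \sum_i \sum_j (x i * y j - x j * y i) ^+ 2.
  by apply: sumr_ge0 => i _; apply: sumr_ge0 => j _; exact: sqr_ge0.
have -> : \sum_i \sum_j (x i * y j - x j * y i) ^+ 2 =
    2 * (nrm2 x * nrm2 y) - 2 * (\sum_i x i * y i) ^+ 2.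
  have e1 : nrm2 x * nrm2 y = \sum_i \sum_j x i ^+ 2 * y j ^+ 2.
    by rewrite /nrm2 mulr_suml; apply: eq_bigr => i _; rewrite mulr_sumr.
  have e2 : nrm2 x * nrm2 y = \sum_i \sum_j x j ^+ 2 * y i ^+ 2 by rewrite e1 exchange_big.
  have e3 : (\sum_i x i * y i) ^+ 2 = \sum_i \sum_j (x i * y i) * (x j * y j).
    by rewrite expr2 mulr_suml; apply: eq_bigr => i _; rewrite mulr_sumr.
  rewrite mulr_natl mulr2n {1}e1 e2 e3 mulr_sumr -big_split -sumrB /=.
  apply: eq_bigr => i _; rewrite mulr_sumr -big_split -sumrB /=.
  by apply: eq_bigr => j _; ring.
lra.
Qed.

Lemma appM (F : realFieldType) n (M N : 'M[F]_n) x i : app (M * N) x i = app M (app N x) i.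
Proof.
rewrite /app (eq_bigr (fun j => \sum_k M i k * N k j * x j)); last first.
  by move=> j _; rewrite mxE mulr_suml.
rewrite exchange_big; apply: eq_bigr => k _; rewrite mulr_sumr.
by apply: eq_bigr => j _; rewrite mulrA.
Qed.

Lemma bil_sqr (F : realFieldType) n (M : 'M[F]_n) x :
  (forall i j, M i j = M j i) -> bil (M * M) x x = nrm2 (app M x).
Proof.
move=> Ms; rewrite bil_app (eq_bigr (fun i => \sum_j M j i * x i * app M x j)).
  rewrite exchange_big; apply: eq_bigr => j _; by rewrite -mulr_suml expr2.
move=> i _; rewrite appM {1}/app mulr_sumr; apply: eq_bigr => j _.
by rewrite (Ms i j) mulrA (mulrC (x i)).
Qed.

Lemma nrm2_app_le (F : realFieldType) n (M : 'M[F]_n) x :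
  (forall i j, M i j = M j i) -> nrm2 (app M x) <= nrm2 x * \tr (M ^+ 2).
Proof.
move=> Ms; rewrite -[2%N]/(2 * 1)%N mxtrace_sqr // expr1 mulrC mulr_suml.
apply: ler_sum => i _; apply: le_trans (cauchy_schwarz _ _) _.
by rewrite le_eqVlt; apply/orP; left; apply/eqP; congr (_ * _); apply: eq_bigr => j _; rewrite Ms.
Qed.

(** Cauchy-Schwarz takes the place of eigenvalues: the square of [x^T M x] is at most [|x|^2] times
    [x^T M^2 x], and this is iterated on [M], [M^2], [M^4] and so on. Hence the exponents are powers
    of two. *)
Lemma bil_pow_le (F : realFieldType) n (M : 'M[F]_n) x j :
  (forall i j, M i j = M j i) ->
  bil M x x ^+ (2 * 2 ^ j) <= nrm2 x ^+ (2 * 2 ^ j) * \tr (M ^+ (2 * 2 ^ j)).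
Proof.
elim: j M => [|j IH] M Ms.
  rewrite expn0 muln1 bil_app; apply: le_trans (cauchy_schwarz _ _) _.
  by rewrite expr2 -mulrA ler_wpM2l ?nrm2_ge0 // nrm2_app_le.
have M2s i l : (M * M) i l = (M * M) l i by have := mxpow_sym 2 Ms i l; rewrite expr2.
have E : (M * M) ^+ (2 ^ j.+1) = M ^+ (2 * 2 ^ j.+1) by rewrite -expr2 -exprM.
have := IH _ M2s; rewrite -expnS E => H.
have x0 := nrm2_ge0 x.
have B0 : 0 <= bil (M * M) x x by rewrite bil_sqr // nrm2_ge0.
rewrite exprM; apply: (@le_trans _ _ ((nrm2 x * bil (M * M) x x) ^+ (2 ^ j.+1))).
  apply: lerXn2r; rewrite ?nnegrE ?sqr_ge0 // ?mulr_ge0 //.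
  by rewrite bil_app bil_sqr //; exact: cauchy_schwarz.
rewrite exprMn mul2n -addnn exprD -mulrA addnn -mul2n.
by rewrite ler_wpM2l // exprn_ge0.
Qed.

Lemma trace_pow_ge0 (F : realFieldType) n (M : 'M[F]_n) k :
  (forall i j, M i j = M j i) -> 0 <= \tr (M ^+ (2 * k)).
Proof. by move=> Ms; rewrite mxtrace_sqr // sumr_ge0 // => i _; exact: nrm2_ge0. Qed.

Definition centred (F : realFieldType) (w : nat -> nat -> F) (e : nat * nat) (b : bool) : F :=
  b%:R - w e.1 e.2.

Lemma centred_moment1 (F : realFieldType) (w : nat -> nat -> F) e :
  moment w (centred w) e 1 = 0.
Proof. by rewrite /moment /centred !expr1 /=; ring. Qed.

(** The values have modulus at most 1, so higher moments are dominated by the variance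
    [v - v ^+ 2]. *)
Lemma centred_moment (F : realFieldType) (w : nat -> nat -> F) (p : F) e k :
  0 <= w e.1 e.2 <= p -> p <= 1 -> (2 <= k)%N -> `|moment w (centred w) e k| <= p.
Proof.
rewrite /moment /centred /=; move: (w e.1 e.2) => v /andP[v0 vp] p1 k2.
have v1 : v <= 1 by exact: le_trans vp p1.
have h1 : `|(1 - v) ^+ k| <= (1 - v) ^+ 2.
  rewrite normrX ger0_norm ?subr_ge0 //; apply: ler_wiXn2l => //; lra.
have h2 : `|(0 - v) ^+ k| <= v ^+ 2.
  by rewrite normrX sub0r normrN ger0_norm //; apply: ler_wiXn2l.
apply: le_trans (ler_normD _ _) _; rewrite !normrM (ger0_norm v0) (@ger0_norm _ (1 - v)) ?subr_ge0 //.
apply: (@le_trans _ _ (v * (1 - v) ^+ 2 + (1 - v) * v ^+ 2)).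
  by apply: lerD; apply: ler_wpM2l => //; rewrite subr_ge0.
have -> : v * (1 - v) ^+ 2 + (1 - v) * v ^+ 2 = v - v ^+ 2 by ring.
by have := sqr_ge0 v; lra.
Qed.

Definition spec_cst (G : nat) : R := (4 * dense_cst) ^+ (6 + 2 * G).

Lemma spectral_moment n G k (p : R) w g0 :
  (0 < k)%N -> 0 <= p <= 1 -> n%:R * p <= (G * k)%:R ->
  (forall e, e \in pairs n -> 0 <= w e.1 e.2 <= p) ->
  p * Ex (pairs n) w g0 (fun g => \tr (symX n (centred w) g ^+ (2 * k))) <=
  (spec_cst G * k%:R) ^+ k.
Proof.
(* The part [6 * k] covers [2 * (2 * k + 1)], twice the number of times of a walk, and [2 * G * k]
   covers [2 * n * p]. In [spec_cst] the base 4 absorbs the prefactor [2 * r]. *)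
move=> k0 p01 np wp; set r := ((6 + 2 * G) * k)%N.
have r0 : (0 < r)%N by rewrite muln_gt0 k0.
have /andP[_ p1] := p01.
apply: le_trans.
  apply: (@Ex_trace_comparison _ n r (2 * k) w (centred w) g0 (@skew_om R) (@skew_vl R) g0 p p01).
  - by rewrite /r; lia.
  - apply: (@le_trans _ _ (2 * (G * k)%:R)); first by rewrite ler_wpM2l.
    by rewrite -natrM ler_nat /r; lia.
  - by move=> e _; exact: centred_moment1.
  - by move=> e l ep l2; apply: centred_moment => //; exact: wp.
  - by move=> e _; exact: skew_moment1.
  - by move=> e l _; exact: skew_moment_ge1.
have rp : 0 < r%:R ^+ k :> R by rewrite exprn_gt0 // ltr0n.
rewrite -(ler_pM2l rp); apply: le_trans (dense_bound g0 k0 r0) _.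
have D0 : 0 <= dense_cst by rewrite /dense_cst mulr_ge0 ?exp_ge0 // mulr_ge0.
have -> : (spec_cst G * k%:R) ^+ k = 4 ^+ r * dense_cst ^+ r * k%:R ^+ k.
  by rewrite exprMn /spec_cst -exprM -/r exprMn.
have h1 : 2 * r%:R <= 4 ^+ r :> R.
  rewrite -natrM -natrX ler_nat; elim: (r) => // m IH; rewrite expnS.
  by have := expn_gt0 4 m; lia.
have h2 : (2 * k)%:R ^+ (2 * k) <= r%:R ^+ k * k%:R ^+ k :> R.
  rewrite exprM -exprMn; apply: lerXn2r; rewrite ?nnegrE ?mulr_ge0 ?sqr_ge0 ?ler0n //.
  by rewrite -natrX -natrM ler_nat /r; nia.
have -> : r%:R ^+ k * (4 ^+ r * dense_cst ^+ r * k%:R ^+ k) =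
  4 ^+ r * dense_cst ^+ r * (r%:R ^+ k * k%:R ^+ k) :> R by ring.
apply: ler_pM h2; rewrite ?mulr_ge0 ?exprn_ge0 ?ler0n //.
by rewrite ler_wpM2r // exprn_ge0.
Qed.

Lemma spectral_norm n (w : nat -> nat -> R) g (t2 : R) j : 0 < t2 ->
  \tr (symX n (centred w) g ^+ (2 * 2 ^ j)) <= t2 ^+ (2 ^ j) ->
  forall x, bil (symX n (centred w) g) x x ^+ 2 <= t2 * nrm2 x ^+ 2.
Proof.
move=> t0 H x; set M := symX _ _ _ in H *.
have Ms i l : M i l = M l i by rewrite !mxE eq_sym edgeC.
have e : (bil M x x ^+ 2) ^+ (2 ^ j) <= (t2 * nrm2 x ^+ 2) ^+ (2 ^ j).
  rewrite [leRHS]exprMn -!exprM mulrC; apply: le_trans (bil_pow_le x j Ms) _.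
  by rewrite ler_wpM2l // exprn_ge0 // nrm2_ge0.
rewrite leNgt; apply/negP => lt; move: e; rewrite leNgt => /negP; apply.
rewrite ltr_pXn2r ?expn_gt0 // nnegrE ?sqr_ge0 //.
by rewrite mulr_ge0 ?sqr_ge0 // ltW.
Qed.

(** * Dual certificates *)

Definition qf (F : realFieldType) n (Z : 'I_n -> 'I_n -> F) (x : 'I_n -> F) : F :=
  \sum_i \sum_j x i * Z i j * x j.

(** Cholesky factorization by Schur complements. A zero pivot forces a zero row; since division by
    zero gives 0, the same formulas cover that case. *)
Lemma gram (F : rcfType) n (Z : 'I_n -> 'I_n -> F) :
  (forall i j, Z i j = Z j i) -> (forall x, 0 <= qf Z x) ->
  exists v : 'I_n -> 'I_n -> F, forall i j, Z i j = \sum_m v m i * v m j.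
Proof.
elim: n Z => [|n IH] Z Zs Zp; first by exists (fun _ _ => 0) => -[].
pose ex (t : F) (x : 'I_n -> F) : 'I_n.+1 -> F :=
  fun i => if unlift ord0 i is Some j then x j else t.
have ex0 t x : ex t x ord0 = t by rewrite /ex unlift_none.
have exS t x i : ex t x (lift ord0 i) = x i by rewrite /ex liftK.
pose z := Z ord0 ord0.
pose c (x : 'I_n -> F) := \sum_i Z ord0 (lift ord0 i) * x i.
pose q (x : 'I_n -> F) := qf (fun i j => Z (lift ord0 i) (lift ord0 j)) x.
have qE t x : qf Z (ex t x) = z * t ^+ 2 + 2 * t * c x + q x.
  rewrite /qf big_ord_recl big_ord_recl ex0.
  rewrite (eq_bigr (fun i => t * (Z ord0 (lift ord0 i) * x i))); last first.
    by move=> i _; rewrite exS; ring.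
  rewrite -mulr_sumr -/(c x).
  rewrite [X in _ + X](eq_bigr (fun i => t * (Z ord0 (lift ord0 i) * x i) +
    \sum_j x i * Z (lift ord0 i) (lift ord0 j) * x j)); last first.
    move=> i _; rewrite big_ord_recl ex0 exS (Zs (lift ord0 i) ord0); congr (_ + _); first by ring.
    by apply: eq_bigr => j _; rewrite exS.
  by rewrite big_split /= -mulr_sumr -/(c x) /z /q /qf; ring.
have z0 : 0 <= z.
  have := Zp (ex 1 (fun=> 0)); rewrite qE.
  have -> : c (fun=> 0) = 0 by apply: big1 => i _; rewrite mulr0.
  have -> : q (fun=> 0) = 0 by apply: big1 => i _; apply: big1 => j _; rewrite mulr0.
  by rewrite expr1n mulr0 !addr0 mulr1.
have cz x : z = 0 -> c x = 0.
  move=> ze; have [//|cn] := eqVneq (c x) 0.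
  (* With a zero pivot the form is affine in [t]; this [t] gives it the value -1. *)
  have := Zp (ex (- (q x + 1) / (2 * c x)) x); rewrite qE ze.
  have -> : 0 * (- (q x + 1) / (2 * c x)) ^+ 2 + 2 * (- (q x + 1) / (2 * c x)) * c x + q x = -1 by field.
  by rewrite ler0N1.
pose Z' (i j : 'I_n) := Z (lift ord0 i) (lift ord0 j) - Z ord0 (lift ord0 i) * Z ord0 (lift ord0 j) / z.
have Z's i j : Z' i j = Z' j i by rewrite /Z' (Zs (lift ord0 i)) (mulrC (Z ord0 (lift ord0 i))).
have qZ' x : qf Z' x = q x - c x ^+ 2 / z.
  have -> : c x ^+ 2 / z = \sum_i \sum_j x i * (Z ord0 (lift ord0 i) * Z ord0 (lift ord0 j) / z) * x j.
    rewrite expr2 {1}/c mulr_suml mulr_suml; apply: eq_bigr => i _.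
    by rewrite /c mulr_sumr mulr_suml; apply: eq_bigr => j _; ring.
  rewrite /q /qf -sumrB; apply: eq_bigr => i _; rewrite -sumrB; apply: eq_bigr => j _.
  by rewrite /Z'; ring.
have Z'p x : 0 <= qf Z' x.
  rewrite qZ'; have [ze|zn] := eqVneq z 0.
    rewrite cz // expr0n mul0r subr0; have := Zp (ex 0 x); rewrite qE cz // ze.
    by have -> : 0 * 0 ^+ 2 + 2 * 0 * 0 + q x = q x by ring.
  (* This [t] minimizes the form, and the minimum is the Schur complement. *)
  have := Zp (ex (- c x / z) x); rewrite qE.
  by have -> : z * (- c x / z) ^+ 2 + 2 * (- c x / z) * c x + q x = q x - c x ^+ 2 / z by field.
have [v vE] := IH _ Z's Z'p.
exists (fun m => if unlift ord0 m is Some m' then ex 0 (v m') else fun i => Z ord0 i / Num.sqrt z).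
have col0 : z = 0 -> forall j, Z ord0 j = 0.
  move=> ze j; case: (unliftP ord0 j) => [j'|] -> //.
  have := cz (fun k => (k == j')%:R) ze; rewrite /c (bigD1 j') //= eqxx mulr1 big1 ?addr0 //.
  by move=> k /negbTE ->; rewrite mulr0.
have head i j : Z ord0 i / Num.sqrt z * (Z ord0 j / Num.sqrt z) = Z ord0 i * Z ord0 j / z.
  rewrite mulrACA -invfM -expr2 sqr_sqrtr //.
move=> i j; rewrite big_ord_recl unlift_none head.
rewrite (eq_bigr (fun m => ex 0 (v m) i * ex 0 (v m) j)); last by move=> m _; rewrite liftK.
case: (unliftP ord0 i) => [i'|] ->; case: (unliftP ord0 j) => [j'|] ->.
- rewrite (eq_bigr (fun m => v m i' * v m j')) -?vE /Z'; last by move=> m _; rewrite !exS.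
  by rewrite addrC subrK.
- rewrite big1 ?addr0; last by move=> m _; rewrite ex0 mulr0.
  have [ze|zn] := eqVneq z 0; last by rewrite -/z mulfK.
  by rewrite Zs !(col0 ze) !mul0r.
- rewrite big1 ?addr0; last by move=> m _; rewrite ex0 mul0r.
  have [ze|zn] := eqVneq z 0; last by rewrite -/z mulrAC mulfV ?mul1r.
  by rewrite !(col0 ze) !mul0r.
rewrite big1 ?addr0; last by move=> m _; rewrite ex0 mul0r.
have [ze|zn] := eqVneq z 0; last by rewrite -/z mulfK.
by rewrite !(col0 ze) !mul0r.
Qed.

Definition csize (F : realFieldType) n (T : finType) (s : 'I_n -> option T) (k : T) : F :=
  \sum_(j | s j == Some k) 1.
Definition cdeg (F : realFieldType) n (T : finType) (s : 'I_n -> option T)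
  (A : 'I_n -> 'I_n -> F) i (k : T) : F := \sum_(j | s j == Some k) A i j.
Definition cedges (F : realFieldType) n (T : finType) (s : 'I_n -> option T)
  (A : 'I_n -> 'I_n -> F) (k l : T) : F := \sum_(i | s i == Some k) cdeg s A i l.
Definition cmat (F : realFieldType) n (T : finType) (s : 'I_n -> option T) (i j : 'I_n) : F :=
  ((s i == s j) && (s i != None))%:R.
Definition sdp_obj (F : realFieldType) n (A : 'I_n -> 'I_n -> F) (eta lam : F)
  (Z : 'I_n -> 'I_n -> F) : F :=
  (\sum_i \sum_j A i j * Z i j) - eta * (\sum_i Z i i) - lam * (\sum_i \sum_j Z i j).

Lemma csize_gt0 (F : realFieldType) n (T : finType) (s : 'I_n -> option T) j k :
  s j = Some k -> 0 < csize F s k.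
Proof.
move=> sj; rewrite /csize (bigD1 j) ?sj //=; apply: ltr_pwDl => //.
exact: sumr_ge0.
Qed.

Lemma sum_const_cluster (F : realFieldType) n (T : finType) (s : 'I_n -> option T)
  (x : F) k : \sum_(j | s j == Some k) x = csize F s k * x.
Proof. by rewrite /csize mulr_suml; apply: eq_bigr => j _; rewrite mul1r. Qed.

Lemma sum_by_cluster (F : realFieldType) n (T : finType) (s : 'I_n -> option T)
  (f : option T -> F) (y : 'I_n -> F) :
  f None = 0 -> (forall k, \sum_(j | s j == Some k) y j = 0) ->
  \sum_j f (s j) * y j = 0.
Proof.
move=> f0 y0; rewrite (partition_big s predT) //=; apply: big1 => o _.
rewrite (eq_bigr (fun j => f o * y j)); last by move=> j /eqP ->.
by rewrite -mulr_sumr; case: o => [k|]; rewrite ?y0 ?mulr0 // f0 mul0r.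
Qed.

Lemma cedgesC (F : realFieldType) n (T : finType) (s : 'I_n -> option T)
  (A : 'I_n -> 'I_n -> F) k l : (forall i j, A i j = A j i) ->
  cedges s A k l = cedges s A l k.
Proof.
move=> As; rewrite /cedges /cdeg (exchange_big_dep (fun j => s j == Some l)) //=.
apply: eq_bigr => j sj; apply: eq_big => [i|i _]; [by rewrite sj andbT|exact: As].
Qed.

(* On the vectors summing to zero on each cluster the quadratic form of [B] vanishes, because
   each block of [B] is the sum of a row term and a column term. *)
Lemma certificate (F : rcfType) n (T : finType) (s : 'I_n -> option T)
  (A Z : 'I_n -> 'I_n -> F) (eta eta' lam : F) :
  (forall i j, A i j = A j i) -> eta' < eta ->
  (forall i k, s i = Some k -> eta + lam * csize F s k < cdeg s A i k) ->
  (forall i j k l, s i = Some k -> s j = Some l -> k != l ->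
     0 < lam - cdeg s A i l / csize F s l - cdeg s A j k / csize F s k +
         cedges s A k l / (csize F s k * csize F s l)) ->
  (forall i k, s i = None -> cdeg s A i k <= lam * csize F s k) ->
  (forall y : 'I_n -> F, (forall k, \sum_(j | s j == Some k) y j = 0) ->
     qf A y <= lam * (\sum_i y i) ^+ 2 + eta' * nrm2 y) ->
  (forall i j, Z i j = Z j i) -> (forall x, 0 <= qf Z x) ->
  (forall i, Z i i <= 1) -> (forall i j, 0 <= Z i j) ->
  sdp_obj A eta lam (cmat F s) <= sdp_obj A eta lam Z ->
  forall i j, Z i j = cmat F s i j.
Proof.
move=> As eta_lt H1 H2 H4 H5 Zs Zp Z1 Z0 Hobj.
pose sz := csize F s; pose deg := cdeg s A; pose ee := cedges s A.
(* Multipliers of the constraints [Z i i <= 1]; the value is forced by requiring that row [i] of [S]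
   sum to zero over the cluster of [i]. *)
pose d i : F := if s i is Some k then deg i k - eta - lam * sz k else 0.
pose P i (o : option T) : F :=
  if o is Some l then if s i == Some l then 0 else lam - deg i l / sz l else 0.
(* Multipliers [B] of [Z i j >= 0] between different clusters: the row and column terms alone do not
   make the rows of [S] sum to zero over a foreign cluster, and the block constant [c] restores
   this. An outlier gets only its own term [P]. *)
pose c (o o' : option T) : F :=
  if o is Some k then if o' is Some l then
    if k == l then 0 else ee k l / (sz k * sz l) - lam else 0 else 0.
pose B i j := P i (s j) + P j (s i) + c (s i) (s j).
pose S i j : F := (i == j)%:R * (d i + eta) - B i j - A i j + lam.
have szn j k : s j = Some k -> sz k != 0 by move=> sj; rewrite gt_eqF // (csize_gt0 F sj).
have d_gt0 i k : s i = Some k -> 0 < d i.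
  by move=> si; rewrite /d si; have := H1 _ _ si; rewrite -/deg -/sz; lra.
have d_ge0 i : 0 <= d i.
  by case si : (s i) => [k|]; [exact: ltW (d_gt0 _ _ si)|rewrite /d si].
have B_gt0 i j k l : s i = Some k -> s j = Some l -> k != l -> 0 < B i j.
  move=> si sj kl; have := H2 _ _ _ _ si sj kl; rewrite /B /P /c si sj (negbTE kl).
  have -> : (Some k == Some l) = false by apply/negbTE.
  have -> : (Some l == Some k) = false by rewrite eq_sym; apply/negbTE.
  by rewrite -/deg -/sz -/ee; lra.
have B_out i j l : s i = None -> s j = Some l -> 0 <= P i (Some l).
  move=> si sj; rewrite /P si /= subr_ge0 ler_pdivrMr; last exact: csize_gt0 sj.
  exact: H4.
have B_ge0 i j : 0 <= B i j.
  case si : (s i) => [k|]; case sj : (s j) => [l|].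
  - have [kl|kl] := eqVneq k l; last exact: ltW (B_gt0 _ _ _ _ si sj kl).
    by rewrite /B /P /c si sj kl !eqxx !addr0.
  - rewrite /B si sj /c !addr0 [P i None]/(0) add0r; exact: B_out sj si.
  - rewrite /B si sj /c !addr0; exact: B_out si sj.
  - by rewrite /B /P /c si sj !addr0.
have B_diag i j : s i = s j -> B i j = 0.
  move=> e; rewrite /B /P /c e; case: (s j) => [k|]; last by rewrite !addr0.
  by rewrite !eqxx !addr0.
have Bs i j : B i j = B j i.
  rewrite /B (addrC (P i _)) /c; congr (_ + _).
  case: (s i) => [k|]; case: (s j) => [l|] //.
  by rewrite eq_sym /ee (cedgesC s k l As) mulrC (mulrC (sz k)) mulrC.
have Ss i j : S i j = S j i.
  rewrite /S Bs As eq_sym; have [->|] := eqVneq j i; by rewrite // !mul0r.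
have S_row i k : \sum_(j | s j == Some k) S i j = 0.
  have [j0 sj0|none] := pickP (fun j => s j == Some k); last by rewrite big_pred0.
  have szk : sz k != 0 by apply: (szn j0); apply/eqP.
  rewrite /S !big_split /= !sumrN sum_const_cluster -/sz -/(cdeg s A i k) -/deg.
  have [si|si] := eqVneq (s i) (Some k).
    rewrite (bigD1 i) ?si //= eqxx mul1r big1 ?addr0; last first.
      by move=> j /andP[_ /negbTE]; rewrite eq_sym => ->; rewrite mul0r.
    rewrite big1; last by move=> j /eqP sj; rewrite B_diag // si sj.
    by rewrite /d si; ring.
  rewrite big1; last first.
    move=> j /eqP sj; have [e|] := eqVneq i j; last by rewrite mul0r.
    by rewrite e sj eqxx in si.
  have -> : \sum_(j | s j == Some k) B i j = lam * sz k - deg i k.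
    rewrite (eq_bigr (fun j => P i (Some k) + P j (s i) + c (s i) (Some k))); last first.
      by move=> j /eqP sj; rewrite /B sj.
    rewrite !big_split /= !sum_const_cluster -/sz /P (negbTE si).
    case si' : (s i) => [l|]; last by rewrite /c big1 //; field.
    have lk : l != k by rewrite si' in si.
    rewrite (eq_bigr (fun j => lam - deg j l / sz l)); last first.
      move=> j /eqP ->; by rewrite eq_sym -si' (negbTE si).
    rewrite sumrB sum_const_cluster -/sz -mulr_suml -/(cedges s A k l) -/ee /c (negbTE lk).
    rewrite /ee (cedgesC s l k As) -/ee.
    by have szl := szn _ _ si'; field; rewrite szl szk.
  by ring.
pose mean (x : 'I_n -> F) (o : option T) : F :=
  if o is Some k then (\sum_(j | s j == Some k) x j) / sz k else 0.
pose dev (x : 'I_n -> F) i := x i - mean x (s i).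
have dev0 x k : \sum_(j | s j == Some k) dev x j = 0.
  have [j0 sj0|none] := pickP (fun j => s j == Some k); last by rewrite big_pred0.
  have szk : sz k != 0 by apply: (szn j0); apply/eqP.
  rewrite sumrB [X in _ - X](eq_bigr (fun=> mean x (Some k))) => [|j /eqP -> //].
  by rewrite [X in _ - X]sum_const_cluster -/sz /mean mulrC mulfVK // subrr.
(* [S] kills the cluster indicators, so it sees only deviations from cluster means. The mean on
   outliers is set to 0, which leaves their coordinates untouched. *)
have S_dev x : qf S x = qf S (dev x).
  have red (y : 'I_n -> F) : qf S y = \sum_i \sum_j dev y i * S i j * y j.
    rewrite /qf exchange_big [RHS]exchange_big; apply: eq_bigr => j _.
    apply/eqP; rewrite -subr_eq0 -sumrB; apply/eqP.
    rewrite (eq_bigr (fun i => y j * (mean y (s i) * S j i))); last first.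
      by move=> i _; rewrite /dev (Ss j i); ring.
    by rewrite -mulr_sumr sum_by_cluster ?mulr0 // => k; exact: S_row.
  rewrite red /qf; apply: eq_bigr => i _.
  apply/eqP; rewrite -subr_eq0 -sumrB; apply/eqP.
  rewrite (eq_bigr (fun j => dev x i * (mean x (s j) * S i j))); last first.
    by move=> j _; rewrite /dev; ring.
  by rewrite -mulr_sumr sum_by_cluster ?mulr0 // => k; exact: S_row.
have S_lb y : (forall k, \sum_(j | s j == Some k) y j = 0) ->
    (eta - eta') * nrm2 y <= qf S y.
  move=> y0.
  have B0 : \sum_i \sum_j y i * B i j * y j = 0.
    have half (f : 'I_n -> option T -> F) : (forall i, f i None = 0) ->
        \sum_i \sum_j y i * f i (s j) * y j = 0.
      move=> f0; apply: big1 => i _; rewrite (eq_bigr (fun j => y i * (f i (s j) * y j))).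
        by rewrite -mulr_sumr sum_by_cluster ?mulr0.
      by move=> j _; rewrite mulrA.
    rewrite (eq_bigr (fun i => \sum_j y i * P i (s j) * y j + \sum_j y j * P j (s i) * y i
        + \sum_j y i * c (s i) (s j) * y j)); last first.
      by move=> i _; rewrite -!big_split; apply: eq_bigr => j _; rewrite /B /=; ring.
    rewrite !big_split /= half //.
    rewrite add0r exchange_big half // add0r (half (fun i => c (s i))) // => i.
    by rewrite /c; case: (s i).
  have D0 : \sum_i \sum_j y i * ((i == j)%:R * (d i + eta)) * y j =
      \sum_i d i * y i ^+ 2 + eta * nrm2 y.
    rewrite mulr_sumr -big_split; apply: eq_bigr => i _ /=.
    rewrite (bigD1 i) //= eqxx mulr1n big1 ?addr0; first by ring.
    by move=> j; rewrite eq_sym => /negbTE ->; rewrite mul0r mulr0 mul0r.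
  have J0 : \sum_i \sum_j y i * lam * y j = lam * (\sum_i y i) ^+ 2.
    rewrite expr2 mulr_suml mulr_sumr; apply: eq_bigr => i _.
    by rewrite mulr_sumr mulr_sumr; apply: eq_bigr => j _; ring.
  have -> : qf S y = \sum_i d i * y i ^+ 2 + eta * nrm2 y - 0 - qf A y + lam * (\sum_i y i) ^+ 2.
    rewrite -J0 -D0 -[X in _ - X - _]B0 /qf -!sumrB -big_split; apply: eq_bigr => i _ /=.
    rewrite -!sumrB -big_split; apply: eq_bigr => j _ /=.
    by rewrite /S; ring.
  have := H5 _ y0.
  have : 0 <= \sum_i d i * y i ^+ 2 by apply: sumr_ge0 => i _; rewrite mulr_ge0 ?sqr_ge0.
  lra.
have S_ge0 x : (eta - eta') * nrm2 (dev x) <= qf S x by rewrite S_dev; exact: S_lb.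
have [v vE] := gram Zs Zp.
have SZ : \sum_i \sum_j S i j * Z i j = \sum_m qf S (v m).
  transitivity (\sum_i \sum_j \sum_m v m i * S i j * v m j).
    apply: eq_bigr => i _; apply: eq_bigr => j _; rewrite vE mulr_sumr.
    by apply: eq_bigr => m _; ring.
  rewrite [RHS]exchange_big; apply: eq_bigr => i _.
  by rewrite [RHS]exchange_big.
(* Weak duality as an identity; at the cluster matrix the last two terms vanish. *)
have objE (W : 'I_n -> 'I_n -> F) : sdp_obj A eta lam W =
    \sum_i d i * W i i - \sum_i \sum_j B i j * W i j - \sum_i \sum_j S i j * W i j.
  have -> : \sum_i \sum_j S i j * W i j = \sum_i d i * W i i + eta * (\sum_i W i i)
      - \sum_i \sum_j B i j * W i j - \sum_i \sum_j A i j * W i j + lam * \sum_i \sum_j W i j.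
    rewrite !mulr_sumr -[in RHS]big_split -!sumrB -big_split; apply: eq_bigr => i _ /=.
    have -> : d i * W i i + eta * W i i = \sum_j (i == j)%:R * (d i + eta) * W i j.
      rewrite (bigD1 i) //= eqxx mulr1n big1 ?addr0; first by ring.
      by move=> j; rewrite eq_sym => /negbTE ->; rewrite !mul0r.
    rewrite mulr_sumr -!sumrB -big_split; apply: eq_bigr => j _ /=.
    by rewrite /S; ring.
  by rewrite /sdp_obj; ring.
have objC : sdp_obj A eta lam (cmat F s) = \sum_i d i.
  rewrite objE [X in _ - X - _]big1; last first.
    move=> i _; apply: big1 => j _; rewrite /cmat.
    by case: eqP => [/B_diag ->|_]; rewrite ?mul0r ?mulr0.
  rewrite [X in _ - X]big1 ?subr0; last first.
    move=> i _; case si : (s i) => [k|]; last first.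
      by apply: big1 => j _; rewrite /cmat si andbF mulr0.
    rewrite -[RHS](S_row i k) [RHS]big_mkcond; apply: eq_bigr => j _.
    by rewrite /cmat si andbT eq_sym; case: ifP => _; rewrite ?mulr1 ?mulr0.
  apply: eq_bigr => i _; rewrite /cmat eqxx /d; case: (s i) => [k|]; by rewrite ?mulr1 ?mul0r.
(* Complementary slackness: the three sums are nonnegative and their total is at most 0, so each of
   their terms vanishes. *)
have e0 : \sum_i d i * (1 - Z i i) + \sum_i \sum_j B i j * Z i j + \sum_m qf S (v m) <= 0.
  move: Hobj; rewrite objC objE SZ.
  have -> : \sum_i d i * (1 - Z i i) = \sum_i d i - \sum_i d i * Z i i.
    by rewrite -sumrB; apply: eq_bigr => i _; ring.
  lra.
have t1 i : 0 <= d i * (1 - Z i i) by rewrite mulr_ge0 // subr_ge0.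
have t2 i j : 0 <= B i j * Z i j by rewrite mulr_ge0.
have t3 m : 0 <= qf S (v m).
  by apply: le_trans (S_ge0 (v m)); rewrite mulr_ge0 ?nrm2_ge0 //; lra.
have s1 : 0 <= \sum_i d i * (1 - Z i i) by apply: sumr_ge0.
have s2 : 0 <= \sum_i \sum_j B i j * Z i j by apply: sumr_ge0 => i _; apply: sumr_ge0.
have s3 : 0 <= \sum_m qf S (v m) by apply: sumr_ge0.
have u1 : \sum_i d i * (1 - Z i i) = 0 by lra.
have u2 : \sum_i \sum_j B i j * Z i j = 0 by lra.
have u3 : \sum_m qf S (v m) = 0 by lra.
have zero (f : 'I_n -> F) : (forall i, 0 <= f i) -> \sum_i f i = 0 -> forall i, f i = 0.
  move=> f0 /eqP; rewrite psumr_eq0 => [/allP H i|i _]; last exact: f0.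
  exact/eqP/(H i (mem_index_enum i)).
have dZ := zero _ t1 u1.
have BZ i j : B i j * Z i j = 0.
  apply: (zero (fun j => B i j * Z i j)) => //.
  by apply: (zero (fun i => \sum_j B i j * Z i j)) => // i'; apply: sumr_ge0.
(* The strict gap [eta' < eta] makes every Gram vector constant on clusters and zero on outliers.
   What is left of [Z] is one value per block, fixed by the strict positivity of [d] and [B]. *)
have vm m i : v m i = mean (v m) (s i).
  have q0 := zero _ t3 u3 m; have := S_ge0 (v m); rewrite q0 pmulr_rle0 ?subr_gt0 // => le0.
  have n0 : nrm2 (dev (v m)) = 0 by apply/eqP; rewrite eq_le le0 nrm2_ge0.
  have /eqP := zero _ (fun i => sqr_ge0 (dev (v m) i)) n0 i.
  by rewrite sqrf_eq0 subr_eq0 => /eqP.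
move=> i j; rewrite /cmat.
case si : (s i) => [k|]; last first.
  by rewrite andbF vE big1 // => m _; rewrite vm si mul0r.
case sj : (s j) => [l|]; last first.
  by rewrite vE big1 // => m _; rewrite (vm m j) sj mulr0.
have [kl|kl] := eqVneq k l.
  have -> : Z i j = Z i i.
    by rewrite !vE; apply: eq_bigr => m _; rewrite (vm m j) (vm m i) si sj kl.
  have /eqP := dZ i; rewrite mulf_eq0 gt_eqF ?(d_gt0 _ _ si) //= subr_eq0 => /eqP <-.
  by rewrite kl eqxx.
have /eqP := BZ i j; rewrite mulf_eq0 gt_eqF ?(B_gt0 _ _ _ _ si sj kl) //= => /eqP ->.
by have -> : (Some k == Some l) = false by apply/negbTE.
Qed.

(** * Consequences of the spectral bound and Chernoff bounds *)

Definition adjm (F : realFieldType) n (g : nat -> nat -> bool) (i j : 'I_n) : F :=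
  if i == j then 0 else let e := edge i j in (g e.1 e.2)%:R.

Lemma adjmC (F : realFieldType) n g (i j : 'I_n) : adjm F g i j = adjm F g j i.
Proof. by rewrite /adjm eq_sym edgeC. Qed.

Definition together n (T : finType) (s : 'I_n -> option T) (i j : 'I_n) : bool :=
  (s i == s j) && (s i != None).

Definition block_prob (F : realFieldType) n (T : finType) (s : 'I_n -> option T)
  (w : nat -> nat -> F) (p q : F) :=
  forall i j : 'I_n, i != j ->
    w (edge i j).1 (edge i j).2 = if together s i j then p else q.

Lemma centred_adjm (F : realFieldType) n (T : finType) (s : 'I_n -> option T) w (p q : F) g i j :
  block_prob s w p q ->
  symX n (centred w) g i j = adjm F g i j - q - (p - q) * (together s i j)%:R +
    (i == j)%:R * (if together s i i then p else q).
Proof.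
move=> H; rewrite mxE /adjm /centred; have [<-|ij] := eqVneq i j.
  by rewrite /=; case: ifP => _; rewrite ?mulr1n ?mulr0n; ring.
by rewrite H //=; case: ifP => _; rewrite ?mulr1n ?mulr0n; ring.
Qed.

(** On such [y] the part [p - q] of the mean vanishes, the missing diagonal of the mean has the
    favourable sign, and the constant part [q] is dominated by [lam]. *)
Lemma spectral_cluster_orth (F : realFieldType) n (T : finType) (s : 'I_n -> option T) w
  (p q lam t : F) g :
  block_prob s w p q -> 0 <= p -> 0 <= q <= lam ->
  (forall x, `|bil (symX n (centred w) g) x x| <= t * nrm2 x) ->
  forall y : 'I_n -> F, (forall k, \sum_(j | s j == Some k) y j = 0) ->
  qf (adjm F g) y <= lam * (\sum_i y i) ^+ 2 + t * nrm2 y.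
Proof.
move=> H p0 /andP[q0 ql] Ht y y0.
have E : bil (symX n (centred w) g) y y = qf (adjm F g) y - q * (\sum_i y i) ^+ 2 -
    (p - q) * 0 + \sum_i (if together s i i then p else q) * y i ^+ 2.
  have E1 : q * (\sum_i y i) ^+ 2 = \sum_i \sum_j y i * q * y j.
    rewrite expr2 mulr_suml mulr_sumr; apply: eq_bigr => i _.
    by rewrite mulr_sumr mulr_sumr; apply: eq_bigr => j _; ring.
  have E2 : (p - q) * 0 = \sum_i \sum_j y i * ((p - q) * (together s i j)%:R) * y j.
    rewrite mulr0; apply/esym; apply: big1 => i _.
    pose f (o : option T) : F := if o is Some _ then (s i == o)%:R else 0.
    rewrite (eq_bigr (fun j => (y i * (p - q)) * (f (s j) * y j))).
      by rewrite -mulr_sumr sum_by_cluster ?mulr0.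
    move=> j _; rewrite /together /f; case sj : (s j) => [k|].
      by case: eqP => [->|_] /=; rewrite ?mulr1n ?mulr0n; ring.
    by rewrite andbN mulr0n; ring.
  have E3 : \sum_i (if together s i i then p else q) * y i ^+ 2 =
      \sum_i \sum_j y i * ((i == j)%:R * (if together s i i then p else q)) * y j.
    apply: eq_bigr => i _; rewrite (bigD1 i) //= eqxx mulr1n big1 ?addr0; first by ring.
    by move=> j; rewrite eq_sym => /negbTE ->; rewrite mul0r mulr0 mul0r.
  rewrite E1 E2 E3 /qf /bil -!sumrB -big_split; apply: eq_bigr => i _ /=.
  rewrite -!sumrB -big_split; apply: eq_bigr => j _ /=.
  by rewrite (centred_adjm _ _ _ H); ring.
have := Ht y; rewrite ler_norml => /andP[_]; rewrite E.
have D : 0 <= \sum_i (if together s i i then p else q) * y i ^+ 2.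
  by apply: sumr_ge0 => i _; rewrite mulr_ge0 ?sqr_ge0 //; case: ifP.
have : q * (\sum_i y i) ^+ 2 <= lam * (\sum_i y i) ^+ 2 by rewrite ler_wpM2r ?sqr_ge0.
lra.
Qed.

(** Polarization of the spectral bound on the indicators of the two clusters and their sum; edge
    counts between clusters thus need no tail bound of their own. *)
Lemma cedges_ge (F : realFieldType) n (T : finType) (s : 'I_n -> option T) w
  (p q t : F) g k l :
  block_prob s w p q -> k != l ->
  (forall x, `|bil (symX n (centred w) g) x x| <= t * nrm2 x) ->
  q * (csize F s k * csize F s l) - t * (csize F s k + csize F s l) <=
  cedges s (adjm F g) k l.
Proof.
move=> H kl Ht; set X := symX n (centred w) g in Ht.
pose u k' (i : 'I_n) : F := (s i == Some k')%:R.
have Xs i j : X i j = X j i by rewrite !mxE eq_sym edgeC.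
have klS : (Some k == Some l) = false by apply/negbTE.
have uu i : u k i * u l i = 0.
  rewrite /u; case: eqP => [->|_]; last by rewrite mul0r.
  by rewrite klS mulr0.
have nu k' : nrm2 (u k') = csize F s k'.
  rewrite /csize big_mkcond; apply: eq_bigr => i _.
  by rewrite /u; case: ifP => _; rewrite ?expr1n ?expr0n.
have nuv : nrm2 (fun i => u k i + u l i) = csize F s k + csize F s l.
  rewrite -!nu -big_split; apply: eq_bigr => i _ /=.
  have -> : (u k i + u l i) ^+ 2 = u k i ^+ 2 + u l i ^+ 2 + 2 * (u k i * u l i) by ring.
  by rewrite uu mulr0 addr0.
have pol : bil X (fun i => u k i + u l i) (fun i => u k i + u l i) =
    bil X (u k) (u k) + bil X (u l) (u l) + 2 * bil X (u k) (u l).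
  have sy : bil X (u l) (u k) = bil X (u k) (u l).
    rewrite /bil exchange_big; apply: eq_bigr => i _; apply: eq_bigr => j _.
    by rewrite (Xs j i); ring.
  have -> : 2 * bil X (u k) (u l) = bil X (u k) (u l) + bil X (u l) (u k).
    by rewrite sy mulr_natl mulr2n.
  rewrite /bil -!big_split; apply: eq_bigr => i _ /=.
  by rewrite -!big_split; apply: eq_bigr => j _ /=; ring.
have E : bil X (u k) (u l) = cedges s (adjm F g) k l - q * (csize F s k * csize F s l).
  rewrite /cedges /cdeg /csize mulr_suml mulr_sumr -sumrB [RHS]big_mkcond; apply: eq_bigr => i _.
  rewrite /u; case: eqP => [si|_]; last by apply: big1 => j _; rewrite !mul0r.
  rewrite mul1r mulr_sumr -sumrB [RHS]big_mkcond; apply: eq_bigr => j _.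
  case: eqP => [sj|_]; last by rewrite mulr0.
  rewrite /X (centred_adjm _ _ _ H) /together si sj klS /=.
  have -> : (i == j) = false by apply/negbTE/eqP => e; move: si; rewrite e sj => -[/esym/eqP]; rewrite (negbTE kl).
  by rewrite mulr1n mulr0n; ring.
have := Ht (u k); have := Ht (u l); have := Ht (fun i => u k i + u l i).
rewrite nuv !nu pol E !ler_norml => /andP[h1 _] /andP[_ h2] /andP[_ h3]; lra.
Qed.

Lemma chernoff n (T : finType) (s : 'I_n -> option T) (w : nat -> nat -> R) g0 i l (pi th : R) :
  0 <= pi <= 1 ->
  (forall j, s j == Some l -> j != i -> w (edge i j).1 (edge i j).2 = pi) ->
  Ex (pairs n) w g0 (fun g => exp (th * cdeg s (adjm R g) i l)) <=
  exp (pi * (exp th - 1) * \sum_(j | (s j == Some l) && (j != i)) 1).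
Proof.
move=> /andP[p0 p1] wp.
pose Q (j : 'I_n) := (s j == Some l) && (j != i).
have inj j j' : Q j -> Q j' -> edge i j = edge i j' -> j = j'.
  move=> _ _ /eqP; rewrite edge_eq => /orP[/andP[_ /eqP e]|/andP[/eqP e1 /eqP e2]].
    exact: val_inj.
  by apply: val_inj; rewrite /= e2 -e1.
(* A product over neighbours [j] is recast as one over edges, as [Ex_prod] requires; for each edge
   at most one [j] contributes. *)
pose h (x : bool -> R) (e : nat * nat) (b : bool) : R := \prod_(j | Q j && (edge i j == e)) x b.
have hE (f : nat * nat -> R) : \prod_(e <- pairs n) \prod_(j | Q j && (edge i j == e)) f e =
    \prod_(j | Q j) f (edge i j).
  rewrite (exchange_big_dep Q) /=; last by move=> e j _ /andP[].
  apply: eq_bigr => j Qj; have /andP[_ ji] := Qj.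
  rewrite big_mkcond (bigD1_seq (edge i j)) ?uniq_pairs ?edge_pairs 1?eq_sym //=.
  rewrite Qj eqxx big1 ?mulr1 // => e; rewrite eq_sym => /negbTE ->.
  by rewrite andbF.
rewrite (Ex_ext _ _ _ (f2 := fun g => \prod_(e <- pairs n) h (fun b => exp (th * b%:R)) e (g e.1 e.2))); last first.
  move=> g; rewrite (hE (fun e => exp (th * (g e.1 e.2)%:R))) -exp_sum -mulr_sumr /cdeg.
  congr (exp (_ * _)); rewrite (bigID (fun j => j != i)) /= [X in _ + X]big1 ?addr0; last first.
    by move=> j /andP[_]; rewrite negbK => /eqP ->; rewrite /adjm eqxx.
  by apply: eq_bigr => j /andP[_ /negbTE ji]; rewrite /adjm eq_sym ji.
rewrite Ex_prod ?uniq_pairs // mulr_sumr exp_sum.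
rewrite (eq_bigr (fun j : 'I_n => (fun=> exp (pi * (exp th - 1))) (edge i j))); last first.
  by move=> j _; rewrite mulr1.
rewrite -(hE (fun=> exp (pi * (exp th - 1)))).
apply: ler_prod => e _; rewrite /h.
have [j /andP[Qj /eqP je]|none] := pickP (fun j => Q j && (edge i j == e)); last first.
  by rewrite !big_pred0 // !mulr1; apply/andP; split; lra.
have uni : (fun j' => Q j' && (edge i j' == e)) =1 pred1 j.
  move=> j' /=; apply/andP/eqP => [[Qj' /eqP e']|->]; last by rewrite Qj je eqxx.
  by apply: inj => //; rewrite e' je.
rewrite !(big_pred1 j uni) -je wp; [|by case/andP: Qj..].
rewrite mulr1 mulr0 expR0; have e0 := exp_ge0 th.
have := exp_ge1D (pi * (exp th - 1)).
by move: (exp (pi * (exp th - 1))) => Y; move: (exp th) e0 => X X0 XY; apply/andP; split; nra.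
Qed.

(** * The objects of the model as sums over finite types *)

Lemma rsumE n (f : nat -> R) : rsum n f = \sum_(i < n) f i.
Proof. by elim: n => [|n IH]; rewrite ?big_ord0 // big_ord_recr /= IH. Qed.

Lemma innerE n (X Y : nat -> nat -> R) :
  inner n X Y = \sum_(i < n) \sum_(j < n) X i j * Y i j.
Proof. by rewrite /inner rsumE; apply: eq_bigr => i _; rewrite rsumE. Qed.

Lemma inner_Imat n (Z : nat -> nat -> R) : inner n Imat Z = \sum_(i < n) Z i i.
Proof.
rewrite innerE; apply: eq_bigr => i _; rewrite (bigD1 i) //= /Imat eqbE eqxx big1 => [|j ji].
  by rewrite mul1r addr0.
by rewrite eqbE eq_sym (inj_eq val_inj) (negbTE ji) mul0r.
Qed.

Lemma inner_Jmat n (Z : nat -> nat -> R) : inner n Jmat Z = \sum_(i < n) \sum_(j < n) Z i j.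
Proof.
by rewrite innerE; apply: eq_bigr => i _; apply: eq_bigr => j _; rewrite mul1r.
Qed.

Lemma obj2E n eta lam A (Z : nat -> nat -> R) :
  obj2 n eta lam A Z =
  sdp_obj (fun i j : 'I_n => A i j) eta lam (fun i j : 'I_n => Z i j).
Proof. by rewrite /obj2 inner_Imat inner_Jmat innerE. Qed.

Lemma psdP n (Z : nat -> nat -> R) :
  psd n Z <-> (forall i j : 'I_n, Z i j = Z j i) /\
              forall x : 'I_n -> R, 0 <= qf (fun i j : 'I_n => Z i j) x.
Proof.
have E x : rsum n (fun i => rsum n (fun j => x i * Z i j * x j)) =
    qf (fun i j : 'I_n => Z i j) (fun i => x i).
  by rewrite rsumE; apply: eq_bigr => i _; rewrite rsumE.
split=> -[Zs Zp]; split.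
- by move=> i j; apply: Zs; apply/ssrnat.ltP.
- move=> x; have /RleP := Zp (ext x); rewrite E => H; apply: le_trans H _.
  rewrite le_eqVlt; apply/orP; left; apply/eqP.
  by apply: eq_bigr => i _; apply: eq_bigr => j _; rewrite !extE.
- by move=> i j /ssrnat.ltP ilt /ssrnat.ltP jlt; exact: (Zs (Ordinal ilt) (Ordinal jlt)).
- by move=> x; rewrite E; exact/RleP.
Qed.

Definition clusters (r n : nat) (sigma : nat -> option nat) : 'I_n -> option 'I_r :=
  fun i => obind insub (sigma i).

Lemma clustersP r n rho sigma (i : 'I_n) : valid_assignment n r rho sigma ->
  sigma i = omap val (clusters r sigma i).
Proof.
case=> + _ => /(_ i (elimT ssrnat.ltP (ltn_ord i))); rewrite /clusters.
by case: (sigma i) => [k|] //= /ssrnat.ltP kr; rewrite insubT.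
Qed.

Lemma cluster_matrixE r n rho sigma (i j : 'I_n) : valid_assignment n r rho sigma ->
  cluster_matrix sigma i j = cmat R (clusters r sigma) i j.
Proof.
move=> V; rewrite /cluster_matrix /cmat (clustersP i V) (clustersP j V).
case: (clusters r sigma i) => [k|] /=; case: (clusters r sigma j) => [l|] //=.
rewrite eqbE andbT -[(Some k == Some l)]/(k == l) -(inj_eq val_inj) /=.
by case: (_ == _).
Qed.

Lemma same_clusterE r n rho sigma (i j : 'I_n) : valid_assignment n r rho sigma ->
  same_cluster sigma i j = together (clusters r sigma) i j.
Proof.
move=> V; rewrite /same_cluster /together (clustersP i V) (clustersP j V).
case: (clusters r sigma i) => [k|] /=; case: (clusters r sigma j) => [l|] //=.
by rewrite eqbE andbT -[(Some k == Some l)]/(k == l) -(inj_eq val_inj).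
Qed.

Lemma csize_Ksize r n rho sigma (k : 'I_r) : valid_assignment n r rho sigma ->
  csize R (clusters r sigma : 'I_n -> _) k = (Ksize rho k n)%:R.
Proof.
move=> V; have [_ H] := V; rewrite -(H k (elimT ssrnat.ltP (ltn_ord k))).
have E m : length (List.filter (in_cluster sigma k) (List.seq 0 m)) =
    (\sum_(i < m) in_cluster sigma k i)%N.
  elim: m => [|m IH]; first by rewrite big_ord0.
  rewrite List.seq_S List.filter_app List.length_app IH big_ord_recr /=; congr addn.
  by case: ifP.
rewrite E natr_sum /csize big_mkcond; apply: eq_bigr => i _.
rewrite /in_cluster (clustersP i V); case: (clusters r sigma i) => [l|] //=.
rewrite eqbE -[Some l == Some k]/(l == k) -(inj_eq val_inj) /=; by case: (_ == _).
Qed.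

Lemma sum_cmat_diag (T : finType) n (s : 'I_n -> option T) :
  \sum_i cmat R s i i = \sum_k csize R s k.
Proof.
rewrite /csize (exchange_big_dep predT) //=; apply: eq_bigr => i _.
rewrite /cmat eqxx /=; case: (s i) => [k|]; last by rewrite big_pred0.
by rewrite (big_pred1 k) // => l; rewrite [LHS]eq_sym.
Qed.

Lemma qf_cmat (T : finType) n (s : 'I_n -> option T) (x : 'I_n -> R) :
  qf (cmat R s) x = \sum_k (\sum_(i | s i == Some k) x i) ^+ 2.
Proof.
rewrite (eq_bigr (fun k => \sum_i \sum_j if (s i == Some k) && (s j == Some k) then x i * x j else 0)).
  rewrite exchange_big; apply: eq_bigr => i _; rewrite exchange_big; apply: eq_bigr => j _ /=.
  rewrite /cmat; case si : (s i) => [k|] /=; last by rewrite andbF mulr0 mul0r big1.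
  rewrite (bigD1 k) //= eqxx /= big1 => [|l /negbTE lk].
    by rewrite addr0 andbT eq_sym; case: ifP => _; rewrite ?mulr1 // mulr0 mul0r.
  by rewrite -[Some k == Some l]/(k == l) eq_sym lk.
move=> k _; rewrite expr2 mulr_suml big_mkcond; apply: eq_bigr => i _.
case: ifP => si; last by rewrite big1.
by rewrite mulr_sumr big_mkcond.
Qed.

Lemma cmat_qf_ge0 (T : finType) n (s : 'I_n -> option T) (x : 'I_n -> R) : 0 <= qf (cmat R s) x.
Proof. by rewrite qf_cmat; apply: sumr_ge0 => k _; exact: sqr_ge0. Qed.

Lemma sum_cmat (T : finType) n (s : 'I_n -> option T) :
  \sum_i \sum_j cmat R s i j = \sum_k csize R s k ^+ 2.
Proof.
transitivity (qf (cmat R s) (fun=> 1)); last by rewrite qf_cmat.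
by apply: eq_bigr => i _; apply: eq_bigr => j _; rewrite mul1r mulr1.
Qed.

Lemma qf_ext n (Z Z' : 'I_n -> 'I_n -> R) x : (forall i j, Z i j = Z' i j) -> qf Z x = qf Z' x.
Proof. by move=> E; apply: eq_bigr => i _; apply: eq_bigr => j _; rewrite E. Qed.

Lemma cluster_matrix_box r n rho sigma : valid_assignment n r rho sigma ->
  sdp_box n (cluster_matrix sigma).
Proof.
move=> V; set s := clusters r sigma : 'I_n -> _.
have E (i j : 'I_n) : cluster_matrix sigma i j = cmat R s i j by exact: cluster_matrixE V.
split; last split.
- apply/psdP; split=> [i j|x]; last by rewrite (qf_ext _ E) cmat_qf_ge0.
  by rewrite !E /cmat; case: eqVneq => [->|]; rewrite // eq_sym => /negbTE ->.
- move=> i /ssrnat.ltP ilt; rewrite (E (Ordinal ilt) (Ordinal ilt)); apply/RleP.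
  by rewrite /cmat lern1 leq_b1.
- move=> i j /ssrnat.ltP ilt /ssrnat.ltP jlt; rewrite (E (Ordinal ilt) (Ordinal jlt)); apply/RleP.
  exact: ler0n.
Qed.

Lemma cluster_matrix_feas1 r n rho sigma : valid_assignment n r rho sigma ->
  feas1 n r rho (cluster_matrix sigma).
Proof.
move=> V; set s := clusters r sigma : 'I_n -> _.
have E (i j : 'I_n) : cluster_matrix sigma i j = cmat R s i j by exact: cluster_matrixE V.
split; first exact: cluster_matrix_box V.
rewrite inner_Imat inner_Jmat (eq_bigr (fun i => cmat R s i i)) // sum_cmat_diag.
rewrite (eq_bigr (fun i => \sum_j cmat R s i j)); last by move=> i _; apply: eq_bigr.
rewrite sum_cmat /sumK /sumK2 !rsumE; split; apply: eq_bigr => k _; rewrite (csize_Ksize _ V).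
  by rewrite INRE.
by rewrite RpowE INRE.
Qed.

(** On the feasible set of the first program the trace and the total sum are those of the cluster
    matrix, so its objective differs from the penalized one by a constant. *)
Lemma certificate_unique r n rho sigma (A : nat -> nat -> R) (eta eta' lam : R) :
  let s : 'I_n -> option 'I_r := clusters r sigma in
  let A' : 'I_n -> 'I_n -> R := fun i j => A i j in
  valid_assignment n r rho sigma ->
  (forall i j, A' i j = A' j i) -> eta' < eta ->
  (forall i k, s i = Some k -> eta + lam * csize R s k < cdeg s A' i k) ->
  (forall i j k l, s i = Some k -> s j = Some l -> k != l ->
     0 < lam - cdeg s A' i l / csize R s l - cdeg s A' j k / csize R s k +
         cedges s A' k l / (csize R s k * csize R s l)) ->
  (forall i k, s i = None -> cdeg s A' i k <= lam * csize R s k) ->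
  (forall y : 'I_n -> R, (forall k, \sum_(j | s j == Some k) y j = 0) ->
     qf A' y <= lam * (\sum_i y i) ^+ 2 + eta' * nrm2 y) ->
  unique_opt n (feas1 n r rho) (fun Z => inner n A Z) (cluster_matrix sigma) /\
  unique_opt n (sdp_box n) (fun Z => obj2 n eta lam A Z) (cluster_matrix sigma).
Proof.
move=> s A' V As eta_lt H1 H2 H4 H5.
have E (i j : 'I_n) : cluster_matrix sigma i j = cmat R s i j by exact: cluster_matrixE V.
have main Z : sdp_box n Z ->
    obj2 n eta lam A (cluster_matrix sigma) <= obj2 n eta lam A Z ->
    mat_eq n Z (cluster_matrix sigma).
  move=> [/psdP[Zs Zp] [Z1 Z0]] H i j /ssrnat.ltP ilt /ssrnat.ltP jlt.
  rewrite -[i]/(val (Ordinal ilt)) -[j]/(val (Ordinal jlt)) E.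
  apply: (certificate As eta_lt H1 H2 H4 H5 Zs Zp).
  - by move=> i'; apply/RleP; apply: Z1; apply/ssrnat.ltP.
  - by move=> i' j'; apply/RleP; apply: Z0; apply/ssrnat.ltP.
  have -> : sdp_obj A' eta lam (cmat R s) = obj2 n eta lam A (cluster_matrix sigma).
    rewrite obj2E /sdp_obj; congr (_ - _ * _ - _ * _).
    - by apply: eq_bigr => i' _; apply: eq_bigr => j' _; rewrite E.
    - by apply: eq_bigr => i' _; rewrite E.
    - by apply: eq_bigr => i' _; apply: eq_bigr => j' _; rewrite E.
  by rewrite -obj2E.
split; split.
- exact: cluster_matrix_feas1.
- move=> Z [Zb [ZI ZJ]] /RleP H; apply: main => //; rewrite /obj2 ZI ZJ.
  have [_ [-> ->]] := cluster_matrix_feas1 V.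
  by rewrite !RminusE lerD2r lerD2r.
- exact: cluster_matrix_box V.
- by move=> Z Zb /RleP H; exact: main.
Qed.

Lemma adjE n g (i j : 'I_n) : adj g i j = adjm R g i j.
Proof.
rewrite /adj /adjm /edge -(inj_eq val_inj) /=.
have ltbE (x y : nat) : Nat.ltb x y = (x < y)%N.
  by apply/idP/idP => [/PeanoNat.Nat.ltb_lt/ssrnat.ltP|/ssrnat.ltP/PeanoNat.Nat.ltb_lt].
by rewrite !ltbE; case: ltngtP => ij //=; case: (g _ _).
Qed.

Lemma probE n w E : prob n w E =
  Ex (pairs n) w (fun _ _ => false) (fun g => Defs.ind (E (adj g))).
Proof.
rewrite /prob; move: (fun _ _ => false); elim: (pairs n) => [|[i j] l IH] g //=.
by rewrite !IH.
Qed.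

(** Markov's inequality at level 1. With [f] a sum of nonnegative terms, one for each bad event, it
    also performs the union bound. *)
Lemma prob_ge n w E f : is_prob (pairs n) w ->
  (forall g, 0 <= f g) -> (forall g, f g < 1 -> E (adj g)) ->
  1 - Ex (pairs n) w (fun _ _ => false) f <= prob n w E.
Proof.
move=> Hw f0 fE; rewrite probE.
have -> : 1 - Ex (pairs n) w (fun _ _ => false) f =
    Ex (pairs n) w (fun _ _ => false) (fun g => 1 + (-1) * f g).
  by rewrite ExD ExZ Ex_cst mulN1r.
apply: Ex_le => // g; rewrite /Defs.ind; case: ClassicalEpsilon.excluded_middle_informative => H.
  by rewrite mulN1r lerBlDr lerDl.
rewrite mulN1r subr_le0 leNgt; apply/negP => lt; exact/H/fE.
Qed.

(** * Exponents and thresholds *)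

(** Used with [s = ln (a / d)], the optimal Chernoff parameter, for which [a - d - d * s] is
    [Ifun a d] and [d / a] is [exp (- s)]. The target [- (1 + e) * L] survives a union bound over
    [n] vertices. *)
Lemma lower_exponent (F : realFieldType) (a d s rho : F) :
  0 < d -> d < a -> 0 <= s -> 0 < rho -> 1 < rho * (a - d - d * s) ->
  exists2 e0, 0 < e0 & forall e, 0 < e -> e <= e0 -> forall x L eta K : F,
    0 < x -> 0 <= L -> 1 <= e * x -> eta <= e * L -> rho * x - 1 <= K ->
    s * (eta + d * L / x * K) + a * L / x * (d / a - 1) * (K - 1) <= - ((1 + e) * L).
Proof.
move=> d0 da s0 r0 rI; set I := a - d - d * s in rI.
have I0 : 0 < I by rewrite -(pmulr_rgt0 _ r0); lra.
have D0 : 0 < I + s + (a - d) + 1 by lra.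
(* The denominator collects the losses proportional to [e]: rounding of [K] ([I]), the shift [eta]
   ([s]), the absent self-loop ([a - d]) and the target itself (1). *)
exists ((rho * I - 1) / (I + s + (a - d) + 1)); first by rewrite divr_gt0 //; lra.
move=> e e0; rewrite ler_pdivlMr // => eD x L eta K x0 L0 ex etaL KL.
set u := L / x.
have u0 : 0 <= u by rewrite divr_ge0 // ltW.
have ux : u * x = L by rewrite /u mulfVK // gt_eqF.
have uL : u <= e * L by rewrite -ux; nra.
have uK : rho * L - u <= u * K by rewrite -ux; nra.
have -> : s * (eta + d * L / x * K) + a * L / x * (d / a - 1) * (K - 1) =
    s * eta - I * (u * K) + u * (a - d) by rewrite /u /I; field; apply/andP; split; lra.
have h1 : s * eta <= s * (e * L) by exact: ler_wpM2l.
have h2 : I * (rho * L - u) <= I * (u * K) by rewrite ler_pM2l.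
have h3 : u * (I + (a - d)) <= e * L * (I + (a - d)) by rewrite ler_wpM2r //; lra.
have h4 : e * (I + s + (a - d) + 1) * L <= (rho * I - 1) * L by rewrite ler_wpM2r.
lra.
Qed.

(** Used with [s = ln (tau / b)], for which [b - tau + tau * s] is [Ifun b tau]. The threshold is
    lowered to [tau - e] to leave a margin for the certificate. *)
Lemma upper_exponent (F : realFieldType) (b tau s rho : F) :
  0 < b -> 0 <= s -> 0 < rho -> 1 < rho * (b - tau + tau * s) ->
  exists2 e0, 0 < e0 & forall e, 0 < e -> e <= e0 -> forall x L K : F,
    0 < x -> 0 <= L -> 1 <= e * x -> rho * x - 1 <= K ->
    s * (- ((tau - e) * L / x * K)) + b * L / x * (tau / b - 1) * K <= - ((1 + e) * L).
Proof.
move=> b0 s0 r0 rI; set I := b - tau + tau * s in rI.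
have I0 : 0 < I by rewrite -(pmulr_rgt0 _ r0); lra.
have D0 : 0 < I + s * rho + 1 by have : 0 <= s * rho by [rewrite mulr_ge0 // ltW]; lra.
exists ((rho * I - 1) / (I + s * rho + 1)); first by rewrite divr_gt0 //; lra.
move=> e e0; rewrite ler_pdivlMr // => eD x L K x0 L0 ex KL.
set u := L / x.
have u0 : 0 <= u by rewrite divr_ge0 // ltW.
have ux : u * x = L by rewrite /u mulfVK // gt_eqF.
have uL : u <= e * L by rewrite -ux; nra.
have uK : rho * L - u <= u * K by rewrite -ux; nra.
have -> : s * (- ((tau - e) * L / x * K)) + b * L / x * (tau / b - 1) * K =
    - ((u * K) * (I - s * e)) by rewrite /u /I; field; apply/andP; split; lra.
have eI : 0 <= e * I by rewrite mulr_ge0 // ltW.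
have es : 0 <= e * (s * rho) by rewrite !mulr_ge0 // ltW.
have J0 : 0 <= I - s * e.
  by rewrite -(pmulr_rge0 _ r0); lra.
have h1 : (rho - e) * L * (I - s * e) <= u * K * (I - s * e) by rewrite ler_wpM2r //; lra.
have ee : 0 <= s * e * e by rewrite !mulr_ge0 // ltW.
have h2 : (1 + e) * L <= (rho - e) * (I - s * e) * L by rewrite ler_wpM2r //; lra.
lra.
Qed.

Lemma fin_eps (T : finType) (P : T -> R -> Prop) :
  (forall x, exists2 e0, 0 < e0 & forall e, 0 < e -> e <= e0 -> P x e) ->
  exists2 e0, 0 < e0 & forall e, 0 < e -> e <= e0 -> forall x, P x e.
Proof.
move=> H; suff : exists2 e0 : R, 0 < e0 & forall e, 0 < e -> e <= e0 -> forall x, x \in enum T -> P x e.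
  by move=> [e0 e00 He]; exists e0 => // e h1 h2 x; apply: He => //; rewrite mem_enum.
elim: (enum T) => [|y l [e1 e10 H1]]; first by exists 1.
have [e2 e20 H2] := H y; exists (Num.min e1 e2); first by rewrite lt_min e10.
move=> e e0; rewrite le_min => /andP[h1 h2] x; rewrite inE => /orP[/eqP ->|]; first exact: H2.
exact: H1.
Qed.

Lemma Ksize_ge rho k n : 0 <= rho k -> rho k * n%:R - 1 <= (Ksize rho k n)%:R.
Proof.
move=> r0; rewrite /Ksize.
have -> : rho k * n%:R = Rmult (rho k) (INR n) by rewrite INRE.
set y := Rmult _ _.
have y0 : Rle (IZR Z0) y by apply/RleP; rewrite /y INRE; apply: mulr_ge0.
clearbody y.
have [h1 h2] := base_Int_part y.
have z0 : Z.le Z0 (Int_part y).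
  case: (Z.lt_ge_cases (Int_part y) Z0) => // /Z.lt_le_pred /IZR_le /= h.
  exfalso; Lra.lra.
rewrite -[leRHS]INRE INR_IZR_INZ Znat.Z2Nat.id //; apply/RleP.
change (Rle (Rminus y (IZR (Zpos xH))) (IZR (Int_part y))); Lra.lra.
Qed.

Lemma ln_ratio (a d : R) : 0 < d -> 0 < a -> ln (exp 1 * a / d) = 1 + ln (a / d).
Proof.
move=> /RltP d0 /RltP a0; rewrite -mulrA ln_mult ?ln_exp //; first exact: exp_pos.
exact: Rdiv_lt_0_compat.
Qed.

(** Supplies a moment order comparable to [L = ln n] of the form [2 ^ j], as [bil_pow_le]
    demands. *)
Lemma pow2_bracket (L : R) : 1 <= L -> exists j : nat, L <= (2 ^ j)%:R <= 2 * L.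
Proof.
move=> L1; have : L <= (2 ^ (Num.truncn L).+1)%:R.
  have /andP[_ /ltW h] := truncn_itv (le_trans ler01 L1).
  by apply: le_trans h _; rewrite ler_nat ltnW // ltn_expl.
elim: (Num.truncn L).+1 => [|m IH] H.
  by exists 0%N; rewrite H expn0; lra.
have [h|h] := lerP L (2 ^ m)%:R; first exact: IH.
by exists m.+1; rewrite H expnS natrM; lra.
Qed.

Lemma exp_ge_sqr (L : R) : 0 <= L -> L ^+ 2 / 4 <= exp L.
Proof.
move=> L0; have -> : exp L = exp (L / 2) ^+ 2 by rewrite expr2 -expD; congr exp; field.
have -> : L ^+ 2 / 4 = (L / 2) ^+ 2 by field.
have := exp_ge1D (L / 2) => h.
by apply: lerXn2r; rewrite ?nnegrE; lra.
Qed.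

Lemma sbm_block_prob r n rho sigma (a b : R) : valid_assignment n r rho sigma ->
  block_prob (clusters r sigma : 'I_n -> _) (sbm_w n a b sigma)
    (a * ln (INR n) / INR n) (b * ln (INR n) / INR n).
Proof.
move=> V i j _; rewrite /sbm_w.
have -> : same_cluster sigma (edge i j).1 (edge i j).2 = together (clusters r sigma) i j.
  rewrite -(same_clusterE i j V) /edge /minn /maxn; case: ltnP => //= _.
  rewrite /same_cluster; case: (sigma i) => [k|]; case: (sigma j) => [l|] //.
  by rewrite !eqbE eq_sym.
by case: ifP => _; rewrite RdivE.
Qed.

(** The deterministic part. [tau v l] is the density allowed for degrees into cluster [l]; two
    families indexed by [v] let each pair of clusters choose which of the two receives which share
    of [b + d]. *)
Lemma event_good r n rho sigma g (a b d eps L x eta t : R) (tau : bool -> 'I_r -> R) :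
  let s : 'I_n -> option 'I_r := clusters r sigma in
  valid_assignment n r rho sigma ->
  L = ln (INR n) -> x = INR n -> 0 < L -> 0 < x -> 0 < eps ->
  0 < b -> b < a -> b < d -> t < eta ->
  (forall k l : 'I_r, k != l -> exists v, tau v l + tau (~~ v) k <= b + d) ->
  (forall l, tau false l <= d) ->
  (forall k, 0 < csize R s k /\ 2 * t / csize R s k <= eps * L / x) ->
  (forall y, `|bil (symX n (centred (sbm_w n a b sigma)) g) y y| <= t * nrm2 y) ->
  (forall i k, s i = Some k ->
     eta + d * L / x * csize R s k < cdeg s (adjm R g) i k) ->
  (forall i k v, s i != Some k ->
     cdeg s (adjm R g) i k < (tau v k - eps) * L / x * csize R s k) ->
  unique_opt n (feas1 n r rho) (fun Z => inner n (adj g) Z) (cluster_matrix sigma) /\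
  unique_opt n (sdp_box n) (fun Z => obj2 n eta (d * L / x) (adj g) Z) (cluster_matrix sigma).
Proof.
move=> s V EL Ex L0 x0 e0 b0 ba bd teta Htau Htau1 HK Hsp Hlow Hup.
have u0 : 0 < L / x by rewrite divr_gt0.
have Ebp := sbm_block_prob a b V; rewrite -EL -Ex -/s in Ebp.
have As : (fun i j : 'I_n => adj g i j) = adjm R g.
  by apply: functional_extensionality => i; apply: functional_extensionality => j; exact: adjE.
have q0 : 0 <= b * L / x by rewrite -mulrA mulr_ge0 // ltW.
have p0 : 0 <= a * L / x by rewrite -mulrA mulr_ge0 // ltW //; lra.
have ql : b * L / x <= d * L / x by rewrite -!mulrA ler_pM2r // ltW.
have divlt (y z K : R) : 0 < K -> y < z * K -> y / K < z by move=> K0; rewrite ltr_pdivrMr.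
apply: (certificate_unique (eta' := t) V); rewrite -/s ?As //.
- by move=> i j; rewrite !adjE adjmC.
- move=> i j k l si sj kl.
  have [[Kk tk] [Kl tl]] := (HK k, HK l).
  have [v Hv] := Htau k l kl.
  have sil : s i != Some l by rewrite si.
  have sjk : s j != Some k by rewrite sj eq_sym.
  have h1 := divlt _ _ _ Kl (Hup i l v sil).
  have h2 := divlt _ _ _ Kk (Hup j k (~~ v) sjk).
  have := cedges_ge Ebp kl Hsp.
  move: (csize R s k) (csize R s l) Kk Kl tk tl h1 h2 => K K' Kk Kl tk tl h1 h2.
  move=> h; have h3 : b * L / x - t / K' - t / K <= cedges s (adjm R g) k l / (K * K').
    rewrite ler_pdivlMr ?mulr_gt0 //; apply: le_trans h; rewrite le_eqVlt; apply/orP; left.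
    by apply/eqP; field; apply/and3P; split; lra.
  have e1 : 2 * t / K = 2 * (t / K) by rewrite mulrA.
  have e2 : 2 * t / K' = 2 * (t / K') by rewrite mulrA.
  rewrite e1 in tk; rewrite e2 in tl.
  (* The two degree bounds yield a margin of [2 * eps], and the spectral error [t / K + t / K']
     spends at most one [eps]. *)
  have h4 : (tau v l + tau (~~ v) k) * (L / x) <= (b + d) * (L / x) by rewrite ler_pM2r.
  have h5 : 0 < eps * (L / x) by rewrite mulr_gt0.
  move: h1 h2 h3 tk tl h4 h5; rewrite -!mulrA.
  move: (L / x) (cdeg _ _ _ _ / _) (cdeg _ _ _ _ / _) (cedges _ _ _ _ / _) (t / K) (t / K').
  by move=> *; lra.
- move=> i k si; have [Kk _] := HK k.
  have sik : s i != Some k by rewrite si.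
  apply: ltW; apply: lt_le_trans (Hup i k false sik) _.
  rewrite ler_pM2r // -!mulrA ler_pM2r //.
  by have := Htau1 k; lra.
- by apply: (spectral_cluster_orth Ebp p0 _ Hsp); rewrite q0.
Qed.

(** * Probability of the exceptional events *)

(** The factor [exp 4] turns the moment bound into a decay [exp (- 4 * k)], enough to pay for the
    prefactor [1 / p <= n] once [k >= ln n]. *)
Definition tail_cst (G : nat) : R := spec_cst G * exp 4.

Lemma tail_cst_gt0 G : 0 < tail_cst G.
Proof.
have e4 := exp_gt0 4; have e16 := exp_gt0 (16 * 16).
apply: mulr_gt0 => //; apply: exprn_gt0; apply: mulr_gt0 => //.
by rewrite /dense_cst; apply: mulr_gt0 => //; apply: mulr_gt0; rewrite ltr0n.
Qed.

Definition spectral_excess n w G j g : R :=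
  \tr (symX n (centred w) g ^+ (2 * 2 ^ j)) / (tail_cst G * (2 ^ j)%:R) ^+ (2 ^ j).

Lemma spectral_den_gt0 G j : 0 < (tail_cst G * (2 ^ j)%:R) ^+ (2 ^ j).
Proof. by rewrite exprn_gt0 // mulr_gt0 ?tail_cst_gt0 // ltr0n expn_gt0. Qed.

Lemma spectral_excess_ge0 n w G j g : 0 <= @spectral_excess n w G j g.
Proof.
apply: divr_ge0; last exact: ltW (spectral_den_gt0 G j).
by apply: trace_pow_ge0 => i l; rewrite !mxE eq_sym edgeC.
Qed.

Lemma spectral_tail n w G j (p : R) g0 :
  0 < p -> p <= 1 -> n%:R * p <= (G * 2 ^ j)%:R ->
  (forall e, e \in pairs n -> 0 <= w e.1 e.2 <= p) ->
  p * Ex (pairs n) w g0 (@spectral_excess n w G j) <= exp (- (4 * (2 ^ j)%:R)).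
Proof.
move=> p0 p1 np wp; set k := (2 ^ j)%N in np *.
have k0 : (0 < k)%N by rewrite expn_gt0.
have p01 : 0 <= p <= 1 by rewrite (ltW p0).
have := spectral_moment g0 k0 p01 np wp.
have D0 := spectral_den_gt0 G j; rewrite -/k in D0.
rewrite (Ex_ext _ _ _ (f2 := fun g => (tail_cst G * k%:R) ^+ k * @spectral_excess n w G j g)); last first.
  by move=> g; rewrite /spectral_excess -/k mulrC mulfVK // gt_eqF.
rewrite ExZ mulrCA -ler_pdivlMl // => h; apply: le_trans h _.
rewrite le_eqVlt; apply/orP; left; apply/eqP.
have S0 : spec_cst G != 0.
  by have := tail_cst_gt0 G; apply: contraTneq; rewrite /tail_cst => ->; rewrite mul0r ltxx.
have -> : exp (- (4 * k%:R)) = exp (-4) ^+ k.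
  by rewrite expRX; congr exp; rewrite -mulNr mulr_natr.
rewrite -exprVn -exprMn; congr (_ ^+ _); rewrite /tail_cst.
have E : exp 4 * exp (-4) = 1 by rewrite -expD subrr expR0.
have e4 : exp 4 != 0 by rewrite gt_eqF // exp_gt0.
have kn : k%:R != 0 :> R by rewrite pnatr_eq0 -lt0n.
apply: (mulfI e4); rewrite E; move: (exp 4) e4 => Y Yn.
by field; rewrite Yn S0 kn.
Qed.

Lemma spectral_excess_lt1 n w G j g (L : R) : 0 <= L -> (2 ^ j)%:R <= 2 * L ->
  @spectral_excess n w G j g < 1 ->
  forall y, `|bil (symX n (centred w) g) y y| <=
            Num.sqrt (2 * tail_cst G) * Num.sqrt L * nrm2 y.
Proof.
move=> L0 kL; rewrite /spectral_excess ltr_pdivrMr ?spectral_den_gt0 // mul1r => /ltW H y.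
have Q0 := tail_cst_gt0 G.
have t0 : 0 < tail_cst G * (2 ^ j)%:R by rewrite mulr_gt0 // ltr0n expn_gt0.
have := spectral_norm t0 H y; set B := bil _ _ _ => hB.
have N0 := nrm2_ge0 y.
rewrite -(@ler_pXn2r _ 2) ?nnegrE ?mulr_ge0 ?sqrtr_ge0 //.
rewrite real_normK ?num_real //; apply: le_trans hB _.
rewrite !exprMn !sqr_sqrtr //; last by rewrite mulr_ge0 // ltW.
rewrite ler_wpM2r ?sqr_ge0 //.
have -> : 2 * tail_cst G * L = tail_cst G * (2 * L) by ring.
by rewrite ler_pM2l.
Qed.

Lemma sqrt_le_linear (y e L : R) : 0 <= y -> 0 < e -> (y / e) ^+ 2 <= L ->
  y * Num.sqrt L <= e * L.
Proof.
move=> y0 e0 h; have L0 : 0 <= L by apply: le_trans h; exact: sqr_ge0.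
have h1 : y / e <= Num.sqrt L.
  have -> : y / e = Num.sqrt ((y / e) ^+ 2) by rewrite sqrtr_sqr ger0_norm // divr_ge0 // ltW.
  exact: ler_wsqrtr.
have h2 : y <= e * Num.sqrt L by rewrite mulrC -ler_pdivrMr.
apply: (@le_trans _ _ (e * Num.sqrt L * Num.sqrt L)); first by rewrite ler_wpM2r ?sqrtr_ge0.
by rewrite -mulrA -expr2 sqr_sqrtr.
Qed.

Lemma exp_ln_ratio (a d : R) : 0 < d -> 0 < a -> exp (ln (a / d)) = a / d.
Proof. by move=> d0 a0; apply: exp_ln; apply/RltP; rewrite divr_gt0. Qed.

Lemma ln_ratio_ge0 (a d : R) : 0 < d -> d <= a -> 0 <= ln (a / d).
Proof.
move=> d0 da; rewrite leNgt; apply/negP => h.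
have a0 : 0 < a by exact: lt_le_trans da.
have : exp (ln (a / d)) < exp 0.
  by apply/RltP; apply: exp_increasing; exact/RltP.
by rewrite exp_ln_ratio // expR0 ltr_pdivrMr // mul1r ltNge da.
Qed.

Lemma lower_event n (T : finType) (s : 'I_n -> option T) (w : nat -> nat -> R) g0 i k
  (pi th eta' : R) : 0 <= pi <= 1 -> s i = Some k ->
  (forall j, s j == Some k -> j != i -> w (edge i j).1 (edge i j).2 = pi) ->
  Ex (pairs n) w g0 (fun g => exp (th * (eta' - cdeg s (adjm R g) i k))) <=
  exp (th * eta' + pi * (exp (- th) - 1) * (csize R s k - 1)).
Proof.
move=> p01 si wp.
rewrite (Ex_ext _ _ _ (f2 := fun g => exp (th * eta') * exp (- th * cdeg s (adjm R g) i k))); last first.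
  by move=> g; rewrite -expD; congr exp; ring.
rewrite ExZ expD ler_wpM2l ?exp_ge0 //.
have := chernoff g0 (- th) p01 wp; set N := \sum_(_ | _) _.
suff -> : N = csize R s k - 1 by [].
rewrite /csize (bigD1 i) ?si //= addrC addrK.
by apply: eq_bigl => j.
Qed.

Lemma upper_event n (T : finType) (s : 'I_n -> option T) (w : nat -> nat -> R) g0 i k
  (pi th z : R) : 0 <= pi <= 1 -> s i != Some k ->
  (forall j, s j == Some k -> j != i -> w (edge i j).1 (edge i j).2 = pi) ->
  Ex (pairs n) w g0 (fun g => exp (th * (cdeg s (adjm R g) i k - z))) <=
  exp (th * (- z) + pi * (exp th - 1) * csize R s k).
Proof.
move=> p01 si wp.
rewrite (Ex_ext _ _ _ (f2 := fun g => exp (th * (- z)) * exp (th * cdeg s (adjm R g) i k))); last first.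
  by move=> g; rewrite -expD; congr exp; ring.
rewrite ExZ expD ler_wpM2l ?exp_ge0 //.
have := chernoff g0 th p01 wp; set N := \sum_(_ | _) _.
suff -> : N = csize R s k by [].
apply: eq_bigl => j; case: eqP => //= sj.
by apply/negP => /eqP e; rewrite -e sj eqxx in si.
Qed.

Lemma fin_lower_bound (T : finType) (f : T -> R) :
  (forall k, 0 < f k) -> exists2 m, 0 < m & forall k, m <= f k.
Proof.
move=> f0; have [|e0 e00 H] := @fin_eps T (fun k e => e <= f k).
  by move=> k; exists (f k).
by exists e0 => // k; exact: H.
Qed.

(** * Recovery for a fixed and for a large number of vertices *)

Definition both_unique n r rho eta lam sigma (A : nat -> nat -> R) : Prop :=
  unique_opt n (feas1 n r rho) (fun Z => inner n A Z) (cluster_matrix sigma) /\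
  unique_opt n (sdp_box n) (fun Z => obj2 n eta lam A Z) (cluster_matrix sigma).

Lemma recovery_fixed_n r n rho sigma (a b d e L x eta C1 : R)
  (tau : bool -> 'I_r -> R) (s0 : R) (sU : bool -> 'I_r -> R) G :
  let s : 'I_n -> option 'I_r := clusters r sigma in
  valid_assignment n r rho sigma ->
  L = ln (INR n) -> x = INR n -> x = exp L -> 1 <= L -> 0 < e -> e <= 1 ->
  0 < b -> b < d -> d < a -> a <= G%:R -> a * L <= x -> 1 <= a * L ->
  1 + 3 * r%:R <= exp (e / 2 * L) ->
  C1 = Num.sqrt (2 * tail_cst G) -> C1 * Num.sqrt L < eta ->
  (forall k l : 'I_r, k != l -> exists v, tau v l + tau (~~ v) k <= b + d) ->
  (forall l, tau false l <= d) ->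
  (forall k, 0 < csize R s k /\ 2 * (C1 * Num.sqrt L) / csize R s k <= e * L / x) ->
  0 < s0 -> (forall v k, 0 < sU v k) ->
  (forall k, s0 * (eta + d * L / x * csize R s k) +
     a * L / x * (exp (- s0) - 1) * (csize R s k - 1) <= - ((1 + e) * L)) ->
  (forall i v k, s i != Some k ->
     sU v k * (- ((tau v k - e) * L / x * csize R s k)) +
     b * L / x * (exp (sU v k) - 1) * csize R s k <= - ((1 + e) * L)) ->
  forall E : (nat -> nat -> R) -> Prop,
  (forall A, both_unique n r rho eta (d * L / x) sigma A -> E A) ->
  1 - Rpower (INR n) (- (e / 2)) <= prob n (sbm_w n a b sigma) E.
Proof.
move=> s V EL Exn Exp L1 e0 e1 b0 bd da aG aLx aL hr EC teta Htau Htau1 HK s00 sU0 Hlow Hup E HE.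
have L0 : 0 < L by lra.
have x0 : 0 < x by rewrite Exp exp_gt0.
have u0 : 0 < L / x by rewrite divr_gt0.
have Ebp := sbm_block_prob a b V; rewrite -EL -Exn -/s in Ebp.
set w := sbm_w n a b sigma in Ebp *.
set p := a * L / x in Ebp Hlow; set q := b * L / x in Ebp Hup.
have p0 : 0 < p by rewrite /p -mulrA mulr_gt0 //; lra.
have p1 : p <= 1 by rewrite /p ler_pdivrMr // mul1r.
have q0 : 0 < q by rewrite /q -mulrA mulr_gt0.
have qp : q <= p by rewrite /p /q -!mulrA ler_pM2r //; lra.
have wp y z : (y < z < n)%N -> 0 <= w y z <= p.
  move=> /andP[yz zn]; have yn : (y < n)%N by exact: ltn_trans yz zn.
  have := Ebp (Ordinal yn) (Ordinal zn).
  rewrite -(inj_eq val_inj) /= ltn_eqF // /edge (minn_idPl (ltnW yz)) (maxn_idPr (ltnW yz)) /=.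
  by move=> -> //; case: ifP => _; apply/andP; split; lra.
have wpe z : z \in pairs n -> 0 <= w z.1 z.2 <= p by case: z => y z; rewrite mem_pairs => /wp.
have Hw : is_prob (pairs n) w.
  by move=> z zp; have /andP[h1 h2] := wpe _ zp; rewrite h1; apply: le_trans h2 p1.
have [j /andP[Lj jL]] := pow2_bracket L1.
set k := (2 ^ j)%N in Lj jL.
have xn : x = n%:R by rewrite Exn INRE.
have np : n%:R * p <= (G * 2 ^ j)%:R.
  rewrite /p -xn mulrC mulfVK ?gt_eqF // natrM; apply: ler_pM => //; lra.
pose lam := d * L / x.
(* Exponential excesses: each is nonnegative and is at least 1 when its degree condition fails, and
   its expectation is the Chernoff bound. *)
pose fL i k g := if s i == Some k then
  exp (s0 * (eta + lam * csize R s k - cdeg s (adjm R g) i k)) else 0.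
pose fU v i k g := if s i != Some k then
  exp (sU v k * (cdeg s (adjm R g) i k - (tau v k - e) * L / x * csize R s k)) else 0.
have fL0 i l g : 0 <= fL i l g by rewrite /fL; case: ifP => // _; exact: exp_ge0.
have fU0 v i l g : 0 <= fU v i l g by rewrite /fU; case: ifP => // _; exact: exp_ge0.
pose h i l g := fL i l g + fU false i l g + fU true i l g.
have h0 i l g : 0 <= h i l g by rewrite /h !addr_ge0.
pose fs := @spectral_excess n w G j.
have fs0 g : 0 <= fs g by exact: spectral_excess_ge0.
pose f g := fs g + \sum_i \sum_l h i l g.
have hs0 g : 0 <= \sum_i \sum_l h i l g by apply: sumr_ge0 => i _; exact: sumr_ge0.
have f0 g : 0 <= f g by rewrite addr_ge0.
have good g : f g < 1 -> both_unique n r rho eta lam sigma (adj g).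
  move=> fg.
  have hlt i l : h i l g < 1.
    apply: le_lt_trans fg; rewrite /f (bigD1 i) //= (bigD1 l) //=.
    have r1 : 0 <= \sum_(i0 | i0 != l) h i i0 g by apply: sumr_ge0.
    have r2 : 0 <= \sum_(i0 | i0 != i) \sum_l0 h i0 l0 g.
      by apply: sumr_ge0 => i' _; apply: sumr_ge0.
    by have := fs0 g; lra.
  have explt (z : R) : exp z < 1 -> z < 0.
    by move=> ez; rewrite ltNge; apply/negP => /exp_mono; rewrite expR0 leNgt ez.
  apply: (event_good (t := C1 * Num.sqrt L) V EL Exn L0 x0 e0 b0 _ bd teta Htau Htau1 HK).
  - exact: lt_trans bd da.
  - rewrite EC; apply: (@spectral_excess_lt1 n w G j g L) => //; first exact: ltW.
    by apply: le_lt_trans fg; rewrite /f lerDl.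
  - move=> i l; rewrite -[clusters r sigma i]/(s i) => si.
    have := hlt i l; rewrite /h => hh.
    have : fL i l g < 1 by have := fU0 false i l g; have := fU0 true i l g; lra.
    by rewrite /fL si eqxx => /explt; rewrite pmulr_rlt0 // subr_lt0.
  - move=> i l v; rewrite -[clusters r sigma i]/(s i) => si.
    have := hlt i l; rewrite /h => hh.
    have : fU v i l g < 1.
      have := fL0 i l g; have := fU0 false i l g; have := fU0 true i l g.
      by case: v; lra.
    by rewrite /fU si => /explt; rewrite pmulr_rlt0 // subr_lt0.
apply: le_trans (prob_ge Hw f0 (fun g fg => HE _ (good g fg))); rewrite lerD2l lerN2.
pose g0 : nat -> nat -> bool := fun _ _ => false; rewrite -/g0.
set z := exp (- ((1 + e) * L)).
have q01 : 0 <= q <= 1 by apply/andP; split; lra.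
have p01 : 0 <= p <= 1 by apply/andP; split; lra.
have ELow i l : Ex (pairs n) w g0 (fL i l) <= z.
  rewrite /fL; case: eqP => [si|_]; last by rewrite Ex_cst exp_ge0.
  apply: le_trans (exp_mono (Hlow l)); apply: lower_event => // i' /eqP si' ii'.
  by rewrite Ebp 1?eq_sym // /together si si' eqxx.
have EUp v i l : Ex (pairs n) w g0 (fU v i l) <= z.
  rewrite /fU; case: (boolP (s i != Some l)) => [si|_]; last by rewrite Ex_cst exp_ge0.
  apply: le_trans (exp_mono (Hup i v l si)); apply: upper_event => // i' /eqP si' ii'.
  by rewrite Ebp 1?eq_sym // /together si' (negbTE si).
have ES : Ex (pairs n) w g0 fs <= exp (- (e * L)).
  have := spectral_tail g0 p0 p1 np wpe; rewrite -/fs -/k => h1.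
  rewrite -(ler_pM2l p0); apply: le_trans h1 _.
  have xi : x^-1 <= p.
    by rewrite /p -[leLHS]mul1r ler_pM2r // invr_gt0.
  apply: (@le_trans _ _ (x^-1 * exp (- (e * L)))); last by rewrite ler_wpM2r // exp_ge0.
  have -> : x^-1 = exp (- L).
    have xx : exp L * exp (- L) = 1 by rewrite -expD subrr expR0.
    have xn0 : x != 0 by rewrite gt_eqF.
    by apply: (mulfI xn0); rewrite mulfV // Exp xx.
  rewrite -expD; apply: exp_mono.
  have : e * L <= 1 * L by rewrite ler_wpM2r // ltW.
  lra.
have -> : Rpower (INR n) (- (e / 2)) = exp (- (e / 2) * L) by rewrite EL.
have Eh i l : Ex (pairs n) w g0 (h i l) <= 3 * z.
  by rewrite /h !ExD; have := ELow i l; have := EUp false i l; have := EUp true i l; lra.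
have Esum : Ex (pairs n) w g0 (fun g => \sum_i \sum_l h i l g) <= x * (r%:R * (3 * z)).
  have -> : x * (r%:R * (3 * z)) = \sum_(i < n) \sum_(l < r) (3 * z).
    by rewrite !sumr_const !card_ord -[RHS]mulr_natl -xn mulr_natl.
  rewrite Ex_sum; apply: ler_sum => i _; rewrite Ex_sum; apply: ler_sum => l _.
  exact: Eh.
have Ef : Ex (pairs n) w g0 f <= exp (- (e * L)) + x * (r%:R * (3 * z)).
  by rewrite /f ExD; exact: lerD ES Esum.
apply: (le_trans Ef).
have -> : z = exp (- L) * exp (- (e * L)) by rewrite /z -expD; congr exp; ring.
have -> : x * (r%:R * (3 * (exp (- L) * exp (- (e * L))))) = 3 * r%:R * exp (- (e * L)).
  have xx : exp L * exp (- L) = 1 by rewrite -expD subrr expR0.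
  rewrite Exp; transitivity (3 * r%:R * exp (- (e * L)) * (exp L * exp (- L))); first by ring.
  by rewrite xx mulr1.
have -> : exp (- (e / 2) * L) = exp (e / 2 * L) * exp (- (e * L)).
  by rewrite -expD; congr exp; field.
(* One spectral term and [3 * r] terms for the degrees, all of size [exp (- (e * L))]; half of the
   exponent pays for the factor [1 + 3 * r]. *)
by rewrite -[X in X + _]mul1r -mulrDl ler_wpM2r // exp_ge0.
Qed.

(** [cond] stands for the possibility that a vertex lies outside some cluster. The exponents of
    upper tails are required under it only, which covers the case of a single cluster without
    outliers. *)
Lemma recovery (r : nat) (rho : nat -> R) (a b d : R) (tau : bool -> 'I_r -> R) (cond : Prop) :
  0 < b -> b < d -> d < a ->
  (forall k : 'I_r, 0 < rho k) ->
  (forall k : 'I_r, 1 < rho k * Ifun a d) ->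
  (forall v k, b < tau v k) ->
  (forall k l : 'I_r, k != l -> exists v, tau v l + tau (~~ v) k <= b + d) ->
  (forall l, tau false l <= d) ->
  (cond -> forall v (k : 'I_r), 1 < rho k * Ifun b (tau v k)) ->
  (forall n sigma (i : 'I_n) (k : 'I_r), valid_assignment n r rho sigma ->
     clusters r sigma i != Some k -> cond) ->
  exists C0 : R, forall C, C0 <= C -> exists c N : R, 0 < c /\
  forall n, N <= n%:R -> forall sigma, valid_assignment n r rho sigma ->
    forall E : (nat -> nat -> R) -> Prop,
    (forall A, both_unique n r rho (C * sqrt (ln (INR n))) (d * ln (INR n) / INR n) sigma A ->
       E A) ->
    1 - Rpower (INR n) (- c) <= prob n (sbm_w n a b sigma) E.
Proof.
move=> b0 bd da rho0 Ia taub Htau Htau1 Ib Hcond.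
have d0 : 0 < d by exact: lt_trans bd.
have a0 : 0 < a by exact: lt_trans da.
pose s0 := ln (a / d).
have s00 : 0 < s0.
  rewrite lt_def ln_ratio_ge0 ?ltW // andbT; apply/eqP => s0E.
  have := exp_ln_ratio d0 a0; rewrite -/s0 s0E expR0 => /esym h.
  by have := da; rewrite -[a](mulfVK (_ : d != 0)) ?gt_eqF // h mul1r ltxx.
have es0 : exp (- s0) = d / a.
  have h : exp s0 * exp (- s0) = 1 by rewrite -expD subrr expR0.
  have := exp_ln_ratio d0 a0; rewrite -/s0 => h2; rewrite h2 in h.
  have adn : a / d != 0 by rewrite gt_eqF // divr_gt0.
  by apply: (mulfI adn); rewrite h; field; apply/andP; split; rewrite gt_eqF.
pose sU v (k : 'I_r) := ln (tau v k / b).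
have tau0 v k : 0 < tau v k by exact: lt_trans (taub v k).
have sU0 v k : 0 < sU v k.
  rewrite lt_def ln_ratio_ge0 ?ltW // andbT; apply/eqP => sE.
  have := exp_ln_ratio b0 (tau0 v k); rewrite -/(sU v k) sE expR0 => /esym h.
  by have := taub v k; rewrite -[tau v k](mulfVK (_ : b != 0)) ?gt_eqF // h mul1r ltxx.
have esU v k : exp (sU v k) = tau v k / b by exact: exp_ln_ratio.
have [el el0 Hel] : exists2 e0, 0 < e0 & forall e, 0 < e -> e <= e0 ->
    forall (k : 'I_r) (x L eta K : R), 0 < x -> 0 <= L -> 1 <= e * x -> eta <= e * L ->
      rho k * x - 1 <= K ->
      s0 * (eta + d * L / x * K) + a * L / x * (d / a - 1) * (K - 1) <= - ((1 + e) * L).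
  apply: fin_eps => k; apply: lower_exponent => //; first exact: ltW.
  have := Ia k; rewrite /Ifun ln_ratio //; congr (1 < rho k * _).
  by rewrite !(RminusE, RmultE) -/s0; ring.
have [eu eu0 Heu] : exists2 e0, 0 < e0 & forall e, 0 < e -> e <= e0 ->
    forall (vk : bool * 'I_r), cond -> forall x L K : R, 0 < x -> 0 <= L -> 1 <= e * x ->
      rho vk.2 * x - 1 <= K ->
      sU vk.1 vk.2 * (- ((tau vk.1 vk.2 - e) * L / x * K)) +
      b * L / x * (tau vk.1 vk.2 / b - 1) * K <= - ((1 + e) * L).
  apply: fin_eps => -[v k] /=; have [hc|nc] := classic cond; last by exists 1.
  have [||||e0 e00 H] := @upper_exponent _ b (tau v k) (sU v k) (rho k) => //; first exact: ltW.
    have := Ib hc v k; rewrite /Ifun ln_ratio //; congr (1 < rho k * _).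
    have -> : ln (b / tau v k) = - sU v k.
      rewrite /sU; have -> : b / tau v k = (tau v k / b)^-1 by rewrite invf_div.
      by rewrite -RinvE ln_Rinv //; apply/RltP; rewrite divr_gt0.
    by rewrite !(RminusE, RmultE); ring.
  by exists e0 => // e e1 e2 _; exact: H.
have [rm rm0 Hrm] := fin_lower_bound rho0.
pose e := Num.min (Num.min el eu) 1.
have e0 : 0 < e by rewrite !lt_min el0 eu0 ltr01.
have [eel eeu e1] : [/\ e <= el, e <= eu & e <= 1].
  by rewrite /e; split; rewrite !ge_min ?lexx ?orbT.
(* Since [n * p = a * L] and the moment order is at least [L], an integer above [a] bounds their
   ratio. *)
pose G := (Num.truncn a).+1.
have aG : a <= G%:R by have /andP[_ /ltW] := truncn_itv (ltW a0).
pose C1 := Num.sqrt (2 * tail_cst G).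
have C10 : 0 <= C1 by exact: sqrtr_ge0.
clearbody e s0 sU; move: (erefl C1) aG; rewrite {2}/C1; clearbody G C1; move=> EC1 aG.
exists (C1 + 1) => C C1C; have C0 : 0 <= C by lra.
have rem0 : 0 < e * rm by exact: mulr_gt0.
(* Each summand is a lower bound that [L] must satisfy for one estimate below; all being
   nonnegative, [L >= l1 + l2] implies each of them. *)
pose l1 : R := 1 + 1 / e + 4 * a + 1 / a + 2 / rm.
pose l2 : R := (C / e) ^+ 2 + (4 * C1 / (e * rm)) ^+ 2 + 2 / e * (3 * r%:R).
exists (e / 2), (exp (l1 + l2)); split; first by rewrite divr_gt0.
move=> n nN sigma V E.
have n0 : 0 < n%:R :> R by exact: lt_le_trans (exp_gt0 _) nN.
pose x := INR n; have xE : x = n%:R by rewrite /x INRE.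
pose L := ln x.
have x0 : 0 < x by rewrite xE.
have Exp : x = exp L by rewrite /L exp_ln //; apply/RltP.
have Lbig : l1 + l2 <= L.
  rewrite leNgt; apply/negP => lt; have : exp L < exp (l1 + l2).
    by apply/RltP; apply: exp_increasing; exact/RltP.
  by rewrite -Exp xE ltNge nN.
have p1 : 0 <= 1 / e by rewrite divr_ge0 // ltW.
have p2 : 0 <= 4 * a by rewrite mulr_ge0 // ltW.
have p3 : 0 <= 1 / a by rewrite divr_ge0 // ltW.
have p4 : 0 <= 2 / rm by rewrite divr_ge0 // ltW.
have p5 : 0 <= (C / e) ^+ 2 by exact: sqr_ge0.
have p6 : 0 <= (4 * C1 / (e * rm)) ^+ 2 by exact: sqr_ge0.
have p7 : 0 <= 2 / e * (3 * r%:R) by rewrite mulr_ge0 ?divr_ge0 ?mulr_ge0 // ltW.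
have [L1 [L2 [L3 [L4 [L5 [L6 [L7 L8]]]]]]] : 1 <= L /\ 1 / e <= L /\ 4 * a <= L /\
    1 / a <= L /\ 2 / rm <= L /\ (C / e) ^+ 2 <= L /\ (4 * C1 / (e * rm)) ^+ 2 <= L /\
    2 / e * (3 * r%:R) <= L.
  move: Lbig; rewrite /l1 /l2; move: p1 p2 p3 p4 p5 p6 p7.
  move: (1 / e) (4 * a) (1 / a) (2 / rm) ((C / e) ^+ 2) ((4 * C1 / (e * rm)) ^+ 2)
    (2 / e * (3 * r%:R)) => y1 y2 y3 y4 y5 y6 y7 *.
  by do ![split]; lra.
have L0 : 0 <= L by exact: le_trans L1.
have xL : L <= x by rewrite Exp; have := exp_ge1D L; lra.
have ex : 1 <= e * x.
  by rewrite mulrC -ler_pdivrMr //; exact: le_trans L2 xL.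
have aLx : a * L <= x.
  apply: le_trans (_ : L ^+ 2 / 4 <= _); last by rewrite Exp; exact: exp_ge_sqr.
  have : 4 * a * L <= L * L by rewrite ler_wpM2r.
  by rewrite expr2; move: (L * L) => LL; lra.
have aL : 1 <= a * L by rewrite mulrC -ler_pdivrMr.
have rmx : 2 <= rm * x by rewrite mulrC -ler_pdivrMr //; exact: le_trans L5 xL.
have hr : 1 + 3 * r%:R <= exp (e / 2 * L).
  apply: le_trans (exp_ge1D _); rewrite lerD2l.
  have -> : 3 * r%:R = e / 2 * (2 / e * (3 * r%:R)) by field; rewrite gt_eqF.
  by rewrite ler_wpM2l // divr_ge0 // ltW.
have sL0 : 0 < Num.sqrt L by rewrite sqrtr_gt0; exact: lt_le_trans L1.
have etaL : C * Num.sqrt L <= e * L by exact: sqrt_le_linear.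
have KE (k : 'I_r) : csize R (clusters r sigma : 'I_n -> _) k = (Ksize rho k n)%:R.
  exact: csize_Ksize V.
have KL (k : 'I_r) : rho k * x - 1 <= csize R (clusters r sigma : 'I_n -> _) k.
  by rewrite KE xE; apply: Ksize_ge; exact: ltW.
have Kx (k : 'I_r) : rm * x / 2 <= csize R (clusters r sigma : 'I_n -> _) k.
  apply: le_trans (KL k); have : rm * x <= rho k * x by rewrite ler_wpM2r // ltW.
  by move: (rm * x) (rho k * x) rmx => y z; lra.
rewrite -[sqrt _]/(sqrt L) RsqrtE => HE.
apply: (recovery_fixed_n (x := x) (L := L) (C1 := C1) (s0 := s0) (sU := sU) (tau := tau) (G := G) V _ _ _ _ _ _ _ _ _ _ _ _ _ _ _ _ _ _ _ _ _ _ HE) => //.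
- by rewrite ltr_pM2r //; lra.
- move=> k; have Kk := Kx k; have rmx0 : 0 < rm * x / 2 by rewrite divr_gt0 // mulr_gt0.
  have Kp := lt_le_trans rmx0 Kk; split=> //.
  rewrite ler_pdivrMr //; apply: (@le_trans _ _ (e * L / x * (rm * x / 2))); last first.
    by rewrite ler_wpM2l // divr_ge0 ?mulr_ge0 // ltW.
  have -> : e * L / x * (rm * x / 2) = e * rm * L / 2 by field; rewrite gt_eqF.
  have c41 : 0 <= 4 * C1 by exact: mulr_ge0.
  have := sqrt_le_linear c41 rem0 L7.
  by rewrite -(mulrA 4); move: (C1 * Num.sqrt L) (e * rm * L) => y z; lra.
- by move=> k; rewrite es0; apply: Hel.
- move=> i v k sik; rewrite esU; apply: (Heu e e0 eeu (v, k)) => //.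
  exact: Hcond V sik.
Qed.

Lemma one_lt_mul (y y' z : R) : 0 < y -> y <= y' -> Rgt z (Rdiv R1 y) -> 1 < y' * z.
Proof.
move=> y0 yy' /RltP; rewrite RdivE => h.
have h1 : 1 < z * y by rewrite -ltr_pdivrMr.
have z0 : 0 < z by rewrite -(pmulr_lgt0 _ y0); exact: lt_trans h1.
by apply: lt_le_trans h1 _; rewrite mulrC ler_pM2r.
Qed.

(** With density exactly 1 the rounded size is [n] itself, so no vertex is left over. *)
Lemma no_outlier r rho n sigma (i : 'I_n) (k : 'I_r) : r = 1%N ->
  valid_assignment n r rho sigma -> rho 0%N = 1 -> clusters r sigma i = Some k.
Proof.
move=> rE; subst r => V r1; apply/eqP; apply/negPn/negP => ik.
have := csize_Ksize k V; rewrite /Ksize (ord1 k) r1.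
have -> : Rmult 1 (INR n) = INR n by rewrite RmultE mul1r.
rewrite Int_part_INR Znat.Nat2Z.id /csize => h.
have : n%:R = \sum_(j < n) (1 : R) by rewrite sumr_const card_ord.
rewrite (bigID (fun j => clusters 1 sigma j == Some ord0)) /= h => /eqP.
rewrite -[X in X == _]addr0 (inj_eq (addrI _)) eq_sym (bigD1 i) /=; last by move: ik; rewrite (ord1 k).
by rewrite gt_eqF // ltr_pwDl // sumr_ge0.
Qed.

Lemma recovery_ifun (r : nat) (rho : nat -> R) (a b psi1 psi2 : R) :
  (1 <= r)%N -> 0 < b -> b < a ->
  (forall k, (k.+1 < r)%N -> rho k.+1 <= rho k) ->
  0 < rho (r - 1)%N -> rsum r rho <= 1 ->
  0 < psi1 -> 0 < psi2 -> b + psi1 + psi2 < a ->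
  Rgt (Ifun a (b + psi1 + psi2)) (Rdiv R1 (rho (r - 1)%N)) ->
  ((2 <= r)%N -> Rgt (Ifun b (b + psi1)) (Rdiv R1 (rho (r - 1)%N))) ->
  ((2 <= r)%N -> Rgt (Ifun b (b + psi2)) (Rdiv R1 (rho (r - 2)%N))) ->
  (r = 1%N -> rsum r rho < 1 -> Rgt (Ifun b (b + psi1 + psi2)) (Rdiv R1 (rho (r - 1)%N))) ->
  exists C0 : R, forall C, C0 <= C -> exists c N : R, 0 < c /\
  forall n, N <= n%:R -> forall sigma, valid_assignment n r rho sigma ->
    forall E : (nat -> nat -> R) -> Prop,
    (forall A, both_unique n r rho (C * sqrt (ln (INR n)))
       ((b + psi1 + psi2) * ln (INR n) / INR n) sigma A -> E A) ->
    1 - Rpower (INR n) (- c) <= prob n (sbm_w n a b sigma) E.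
Proof.
move=> r1 b0 ba mono rl0 rs1 p1 p2 da I1 I2 I3 I4.
have rmono k l : (k <= l)%N -> (l < r)%N -> rho l <= rho k.
  elim: l => [|l IH]; first by rewrite leqn0 => /eqP ->.
  rewrite leq_eqVlt => /orP[/eqP -> //|kl] lr.
  by apply: le_trans (mono _ lr) (IH kl (ltnW lr)).
have rk (k : 'I_r) : rho (r - 1)%N <= rho k.
  by apply: rmono; have := ltn_ord k; lia.
pose d := b + psi1 + psi2.
(* The share [b + psi2] is never given to the last cluster, so it is only compared with sizes at
   least the last but one. In a pair, [v] is chosen so that a cluster other than the last receives
   it. *)
pose tau (v : bool) (l : 'I_r) := if r == 1%N then d else
  if v && (l < r - 1)%N then b + psi2 else b + psi1.
apply: (@recovery r rho a b d tau ((2 <= r)%N \/ rsum r rho < 1)) => //.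
- by rewrite /d; lra.
- by move=> k; exact: lt_le_trans (rk k).
- by move=> k; exact: one_lt_mul I1.
- by move=> v k; rewrite /tau /d; case: ifP => _; [|case: ifP => _]; lra.
- move=> k l kl.
  have r2 : (r == 1%N) = false.
    apply/negbTE; apply: contra_neq kl => rE; apply: val_inj => /=.
    by have := ltn_ord k; have := ltn_ord l; lia.
  have [lr|lr] := ltnP l (r - 1); first by exists true; rewrite /tau r2 lr /= /d; lra.
  have kr : (k < r - 1)%N.
    have : (k : nat) != l by rewrite (inj_eq val_inj).
    by have := ltn_ord k; have := ltn_ord l; lia.
  by exists false; rewrite /tau r2 kr /= /d; lra.
- by move=> l; rewrite /tau /d; case: ifP => _ //=; lra.
- move=> hc v k; rewrite /tau; case: eqP => rE.
    case: hc => [r2|hc]; first by exfalso; lia.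
    exact: one_lt_mul (I4 rE hc).
  have r2 : (2 <= r)%N by lia.
  case: ifP => [/andP[_ kr]|_]; last exact: one_lt_mul (I2 r2).
  apply: one_lt_mul (I3 r2).
    by apply: lt_le_trans rl0 _; apply: rmono; lia.
  by apply: rmono; lia.
- move=> n sigma i k V ik.
  have [r2|r2] := leqP 2 r; [by left|right].
  have rE : r = 1%N by lia.
  rewrite lt_neqAle rs1 andbT; apply/eqP => e; move/negP: ik; apply; apply/eqP.
  have e0 : rho 0%N = 1.
    by move: (e); have -> : rsum r rho = rho 0%N by rewrite rE /= RplusE add0r.
  exact: no_outlier rE V e0.
Qed.

Lemma recovery_probability (r : nat) (rho : nat -> R) (a b psi1 psi2 : R) :
  (1 <= r)%coq_nat -> Rlt 0 b -> Rlt b a ->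
  (forall k, (S k < r)%coq_nat -> Rle (rho (S k)) (rho k)) ->
  Rlt 0 (rho (r - 1)%coq_nat) -> Rle (rsum r rho) 1 ->
  Rlt 0 psi1 -> Rlt 0 psi2 -> Rlt (b + psi1 + psi2) a ->
  Rgt (Ifun a (b + psi1 + psi2)) (1 / rho (r - 1)%coq_nat) ->
  ((2 <= r)%coq_nat -> Rgt (Ifun b (b + psi1)) (1 / rho (r - 1)%coq_nat)) ->
  ((2 <= r)%coq_nat -> Rgt (Ifun b (b + psi2)) (1 / rho (r - 2)%coq_nat)) ->
  (r = 1%N -> Rlt (rsum r rho) 1 ->
     Rgt (Ifun b (b + psi1 + psi2)) (1 / rho (r - 1)%coq_nat)) ->
  exists C0 : R, forall C, Rge C C0 -> exists c N : R, Rlt 0 c /\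
  forall n, Rge (INR n) N -> forall sigma, valid_assignment n r rho sigma ->
    forall E : (nat -> nat -> R) -> Prop,
    (forall A, both_unique n r rho (Rmult C (sqrt (ln (INR n))))
       (Rdiv (Rmult (b + psi1 + psi2) (ln (INR n))) (INR n)) sigma A -> E A) ->
    Rge (prob n (sbm_w n a b sigma) E) (1 - Rpower (INR n) (- c)).
Proof.
move=> r1 /RltP b0 /RltP ba mono /RltP rl0 /RleP rs1 /RltP p1 /RltP p2 /RltP da I1 I2 I3 I4.
have [|||||C0 H] := @recovery_ifun r rho a b psi1 psi2 _ b0 ba _ rl0 rs1 p1 p2 da I1.
- exact/ssrnat.leP.
- by move=> k kr; apply/RleP; apply: mono; exact/ssrnat.ltP.
- by move=> /ssrnat.leP; exact: I2.
- by move=> /ssrnat.leP; exact: I3.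
- by move=> rE /RltP; exact: I4.
exists C0 => C /Rge_le/RleP CC0; have [c [N [c0 HN]]] := H C CC0.
exists c, N; split; first exact/RltP.
move=> n nN sigma V E HE; apply: Rle_ge; apply/RleP; apply: (HN n _ sigma V E).
  by rewrite -INRE; apply/RleP; exact: Rge_le.
by move=> A HA; apply: HE; rewrite RdivE.
Qed.

End Recovery.

Theorem theorem8 (r : nat) (rho : nat -> R) (a b psi1 psi2 : R) :
  (1 <= r)%nat ->
  0 < b -> b < a ->
  (forall k, (S k < r)%nat -> rho (S k) <= rho k) ->
  0 < rho (r - 1)%nat ->
  rsum r rho <= 1 ->
  0 < psi1 -> 0 < psi2 -> b + psi1 + psi2 < a ->
  Ifun a (b + psi1 + psi2) > 1 / rho (r - 1)%nat ->
  ((2 <= r)%nat -> Ifun b (b + psi1) > 1 / rho (r - 1)%nat) ->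
  ((2 <= r)%nat -> Ifun b (b + psi2) > 1 / rho (r - 2)%nat) ->
  (r = 1%nat -> rsum r rho < 1 -> Ifun b (b + psi1 + psi2) > 1 / rho (r - 1)%nat) ->
  (* SDP (i) *)
  (exists c N : R, 0 < c /\ forall n : nat, INR n >= N ->
     forall sigma, valid_assignment n r rho sigma ->
       prob n (sbm_w n a b sigma)
         (fun A => unique_opt n (feas1 n r rho) (fun Z => inner n A Z)
                     (cluster_matrix sigma))
       >= 1 - Rpower (INR n) (- c)) /\
  (* SDP (ii), with eta* = C sqrt(log n), C sufficiently large *)
  (exists C0 : R, forall C : R, C >= C0 ->
   exists c N : R, 0 < c /\ forall n : nat, INR n >= N ->
     forall sigma, valid_assignment n r rho sigma ->
       prob n (sbm_w n a b sigma)
         (fun A => unique_opt n (sdp_box n)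
                     (fun Z => obj2 n (C * sqrt (ln (INR n)))
                                 ((b + psi1 + psi2) * ln (INR n) / INR n) A Z)
                     (cluster_matrix sigma))
       >= 1 - Rpower (INR n) (- c)).
Proof.
  intros r1 b0 ba mono rl0 rs1 p1 p2 da I1 I2 I3 I4.
  destruct (Recovery.recovery_probability r1 b0 ba mono rl0 rs1 p1 p2 da I1 I2 I3 I4)
    as [C0 H].
  split.
  (* The first program does not involve [eta], which enters only through the certificate, so any
     admissible [C] will do. *)
  - destruct (H C0 (Rge_refl C0)) as (c & N & c0 & HN).
    exists c, N; split; [exact c0|].
    intros n nN sigma V; apply (HN n nN sigma V); intros A [HA _]; exact HA.
  - exists C0; intros C HC; destruct (H C HC) as (c & N & c0 & HN).
    exists c, N; split; [exact c0|].
    intros n nN sigma V; apply (HN n nN sigma V); intros A [_ HA]; exact HA.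
Qed.
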